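(* Let $\gamma$ be a closed simple smooth regular plane curve in $\mathbb{R}^2$. Then there exist four distinct points $p_1, p_2, q_1, q_2$ on $\gamma$ such that the osculating circline of $\gamma$ at $p_1$ supports $\gamma$ at $p_1$ from inside, the osculating circline of $\gamma$ at $p_2$ supports $\gamma$ at $p_2$ from inside, the osculating circline of $\gamma$ at $q_1$ supports $\gamma$ at $q_1$ from outside, and the osculating circline of $\gamma$ at $q_2$ supports $\gamma$ at $q_2$ from outside.
   Context: A circline is a circle or a (straight) line in the plane. The osculating circline of a smooth ($C^\infty$) regular plane curve at a point $x$ is the unique circline having second order of contact with the curve at $x$. That is, it passes through $x$ with the same tangent line and the same signed curvature as the curve. It is a line if the curvature of the curve at $x$ vanishes, and a circle otherwise. A closed simple curve $\gamma$ in the plane cuts the plane into two closed regions: the bounded closed region (the inside together with $\gamma$) and the unbounded closed region (the outside together with $\gamma$). A circline $\sigma$ supports $\gamma$ at a point $p$ if $p$ lies on both $\sigma$ and $\gamma$, and $\sigma$ (as a set of points, that is, the circle or line itself) lies in one of these two closed regions. If $\sigma$ lies in the bounded closed region, then $\sigma$ supports $\gamma$ from inside; if $\sigma$ lies in the unbounded closed region, then $\sigma$ supports $\gamma$ from outside. (If $\gamma$ is itself a circle, its osculating circle lies in both closed regions and so supports it both from inside and from outside.) *)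

(* Defs.v *)
From HB Require Import structures.
From mathcomp Require Import all_boot all_order all_algebra.
From mathcomp Require Import all_classical all_reals all_analysis.
From mathcomp Require Import ring lra.

Set Implicit Arguments.
Unset Strict Implicit.
Unset Printing Implicit Defensive.

Import Order.TTheory GRing.Theory Num.Theory.
Import numFieldNormedType.Exports.

Local Open Scope ring_scope.
Local Open Scope classical_set_scope.

Section Definitions.
Variable R : realType.
Implicit Types (f : R -> R) (c g : R -> R * R) (t u : R) (p : R * R).
Implicit Types (S G : set (R * R)).

Definition smooth f := forall (n : nat) t, derivable (f^`(n)) t 1.

Definition xcoord c : R -> R := fun t => (c t).1.
Definition ycoord c : R -> R := fun t => (c t).2.

Definition velocity c t : R * R := ((xcoord c)^`() t, (ycoord c)^`() t).

Definition acceleration c t : R * R := ((xcoord c)^`(2) t, (ycoord c)^`(2) t).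

(* c is defined on the whole line; a closed curve is given by a periodic
   parametrization, so that it also closes up smoothly. *)
Definition regular_smooth_curve c :=
  [/\ smooth (xcoord c), smooth (ycoord c) & forall t, velocity c t != 0].

Definition closed_simple_curve c (L : R) :=
  [/\ 0 < L, forall t, c (t + L) = c t &
      forall t u, 0 <= t < L -> 0 <= u < L -> c t = c u -> t = u].

Definition signed_curvature c t : R :=
  let v := velocity c t in let a := acceleration c t in
  (v.1 * a.2 - v.2 * a.1) / Num.sqrt (v.1 ^+ 2 + v.2 ^+ 2) ^+ 3.

Definition is_circle S := exists (o : R * R) (r : R), 0 < r /\
  S = [set q | (q.1 - o.1) ^+ 2 + (q.2 - o.2) ^+ 2 = r ^+ 2].

Definition is_line S := exists a b d : R, (a, b) != 0 /\
  S = [set q | a * q.1 + b * q.2 = d].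

Definition circline S := is_circle S \/ is_line S.

(* The sign of the curvature depends on the orientation, so S is traced through
   g t by a regular curve c whose velocity there is a positive multiple of that
   of g; the tangent lines then agree and the curvatures are comparable. *)
Definition osculating_circline_at g t S := circline S /\
  exists c u, [/\ regular_smooth_curve c, range c `<=` S, c u = g t,
    exists2 l : R, 0 < l & velocity c u = l *: velocity g t &
    signed_curvature c u = signed_curvature g t].

Definition unit_tangent c t : R * R :=
  (Num.sqrt ((velocity c t).1 ^+ 2 + (velocity c t).2 ^+ 2))^-1 *: velocity c t.

(* Tangent line if the curvature k vanishes, and otherwise the circle of radius
   1/|k| centred at distance 1/k along the left normal; osculating_circline_atE
   shows that this is the unique osculating circline. *)
Definition osculating_formula g t : set (R * R) :=
  let p := g t in let k := signed_curvature g t in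
  let n := (- (unit_tangent g t).2, (unit_tangent g t).1) in
  let o := p + k^-1 *: n in
  if k == 0 then [set q | n.1 * (q.1 - p.1) + n.2 * (q.2 - p.2) = 0]
  else [set q | (q.1 - o.1) ^+ 2 + (q.2 - o.2) ^+ 2 = k^-1 ^+ 2].

Definition osculating_circline g p S :=
  exists2 t, g t = p & osculating_circline_at g t S.

(* For a Jordan curve G the complement has exactly one bounded and one unbounded
   component; points are sorted by the boundedness of their component. *)
Definition inside G : set (R * R) :=
  [set p | ~ G p /\ bounded_set (connected_component (~` G) p)].
Definition outside G : set (R * R) :=
  [set p | ~ G p /\ ~ bounded_set (connected_component (~` G) p)].

Definition bounded_closed_region G := inside G `|` G.
Definition unbounded_closed_region G := outside G `|` G.

Definition supports_from_inside S G p :=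
  [/\ S p, G p & S `<=` bounded_closed_region G].
Definition supports_from_outside S G p :=
  [/\ S p, G p & S `<=` unbounded_closed_region G].

End Definitions.


Section Osculating.
Variable R : realType.
Implicit Types (f : R -> R) (c g : R -> R * R) (t u : R).

Lemma smooth_derive f t : smooth f -> is_derive t 1 f (f^`() t).
Proof. by move=> /(_ 0 t) h; rewrite derive1E; exact: derivableP. Qed.

Lemma smooth_derive2 f t : smooth f -> is_derive t 1 (f^`()) (f^`(2) t).
Proof.
move=> /(_ 1 t) h; rewrite derive1nS derive1n1 derive1E; exact: derivableP.
Qed.

Let trigf (k a d b e : R) : R -> R :=
  fun u => a + d * u + b * cos (k * u) + e * sin (k * u).

Let is_derive_trigf k a d b e u :
  is_derive u 1 (trigf k a d b e) (trigf k d 0 (k * e) (- (k * b)) u).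
Proof.
rewrite /trigf.
have hl : is_derive u 1 (fun u : R => k * u) k.
  by apply: is_derive_eq; rewrite /= /GRing.scale /= mulr1.
have hc : is_derive u 1 (fun u : R => cos (k * u)) (- sin (k * u) * k).
  exact: (@is_derive1_comp R cos (fun u => k * u) u).
have hs : is_derive u 1 (fun u : R => sin (k * u)) (cos (k * u) * k).
  exact: (@is_derive1_comp R sin (fun u => k * u) u).
apply: is_derive_eq; rewrite /GRing.scale /=; ring.
Qed.

Let trigf_derive k a d b e :
  (trigf k a d b e)^`() = trigf k d 0 (k * e) (- (k * b)).
Proof. by apply/funext => u; rewrite derive1E; case: (is_derive_trigf k a d b e u). Qed.

Let trigf_smooth k a d b e : smooth (trigf k a d b e).
Proof.
move=> n; elim: n a d b e => [|n IHn] a d b e t; first by case: (is_derive_trigf k a d b e t).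
by rewrite /derive1n iterSr trigf_derive; exact: IHn.
Qed.

Let speed c t : R := Num.sqrt ((velocity c t).1 ^+ 2 + (velocity c t).2 ^+ 2).

Let speed_gt0 c t : velocity c t != 0 -> 0 < speed c t.
Proof.
move=> v0; rewrite sqrtr_gt0 lt_neqAle addr_ge0 ?sqr_ge0// andbT eq_sym.
rewrite paddr_eq0 ?sqr_ge0// !sqrf_eq0; apply: contra v0 => /andP[/eqP h1 /eqP h2].
by apply/eqP; rewrite [LHS]surjective_pairing h1 h2.
Qed.

Let speed_sqr c t :
  speed c t ^+ 2 = (velocity c t).1 ^+ 2 + (velocity c t).2 ^+ 2.
Proof. by rewrite sqr_sqrtr// addr_ge0 ?sqr_ge0. Qed.

Let velocityE c t : velocity c t != 0 ->
  (velocity c t).1 = speed c t * (unit_tangent c t).1 /\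
  (velocity c t).2 = speed c t * (unit_tangent c t).2.
Proof.
move=> /speed_gt0/lt0r_neq0 h.
by split; rewrite /unit_tangent /= /GRing.scale /= mulVKf.
Qed.

Let unit_tangent_sqr c t : velocity c t != 0 ->
  (unit_tangent c t).1 ^+ 2 + (unit_tangent c t).2 ^+ 2 = 1.
Proof.
move=> v0; have h := lt0r_neq0 (speed_gt0 v0); have [e1 e2] := velocityE v0.
have := speed_sqr c t; rewrite e1 e2 !exprMn -mulrDr => /esym/eqP.
rewrite -[X in _ == X]mulr1 => /eqP; apply: mulfI; exact: expf_neq0.
Qed.

Let curvature_num c t : velocity c t != 0 ->
  (unit_tangent c t).1 * (acceleration c t).2 -
  (unit_tangent c t).2 * (acceleration c t).1 =
  signed_curvature c t * speed c t ^+ 2.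
Proof.
move=> v0; have h := lt0r_neq0 (speed_gt0 v0); have [e1 e2] := velocityE v0.
rewrite /signed_curvature -/(speed c t) e1 e2.
move: (speed c t) h (unit_tangent c t).1 (unit_tangent c t).2 => s h x y.
move: (acceleration c t).1 (acceleration c t).2 => a b.
by field.
Qed.

Let is_derive_dot (a b x' y' z' w' t : R) (x y z w : R -> R) :
  is_derive t 1 x x' -> is_derive t 1 y y' ->
  is_derive t 1 z z' -> is_derive t 1 w w' ->
  is_derive t 1 (fun t => (x t - a) * z t + (y t - b) * w t)
    (x' * z t + (x t - a) * z' + (y' * w t + (y t - b) * w')).
Proof.
by move=> ? ? ? ?; apply: is_derive_eq; rewrite /GRing.scale /=; ring.
Qed.

Let is_derive_lin (a b x' y' t : R) (x y : R -> R) :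
  is_derive t 1 x x' -> is_derive t 1 y y' ->
  is_derive t 1 (fun t => a * x t + b * y t) (a * x' + b * y').
Proof. by move=> ? ?; apply: is_derive_eq; rewrite /GRing.scale /=; ring. Qed.

Let derive_const (f : R -> R) (d t l : R) :
  is_derive t 1 f l -> (forall t, f t = d) -> l = 0.
Proof.
move=> + fd; rewrite (_ : f = cst d); last exact/funext.
by move=> [_ <-]; rewrite derive_cst.
Qed.

Let line_contact c u (a b d : R) : regular_smooth_curve c ->
  (forall t, a * (c t).1 + b * (c t).2 = d) ->
  a * (velocity c u).1 + b * (velocity c u).2 = 0 /\
  a * (acceleration c u).1 + b * (acceleration c u).2 = 0.
Proof.
move=> [sx sy _] h.
have D1 t : a * (velocity c t).1 + b * (velocity c t).2 = 0.
  by apply: derive_const (is_derive_lin a b (smooth_derive t sx)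
                                        (smooth_derive t sy)) h.
split=> //.
exact: derive_const (is_derive_lin a b (smooth_derive2 u sx)
                                   (smooth_derive2 u sy)) D1.
Qed.

Let circle_contact c u (a b d : R) : regular_smooth_curve c ->
  (forall t, ((c t).1 - a) ^+ 2 + ((c t).2 - b) ^+ 2 = d) ->
  ((c u).1 - a) * (velocity c u).1 + ((c u).2 - b) * (velocity c u).2 = 0 /\
  (velocity c u).1 ^+ 2 + (velocity c u).2 ^+ 2 +
  (((c u).1 - a) * (acceleration c u).1 + ((c u).2 - b) * (acceleration c u).2)
  = 0.
Proof.
move=> [sx sy _] h.
have D1 t : ((c t).1 - a) * (velocity c t).1 + ((c t).2 - b) * (velocity c t).2 = 0.
  have hx := smooth_derive t sx; have hy := smooth_derive t sy.
  have h' s : (xcoord c s - a) * xcoord c s + (ycoord c s - b) * ycoord c s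
      - (a * xcoord c s + b * ycoord c s) = d - (a ^+ 2 + b ^+ 2).
    by rewrite -(h s) /xcoord /ycoord; ring.
  have alg (x y x' y' : R) : x' * x + (x - a) * x' + (y' * y + (y - b) * y')
      - (a * x' + b * y') = 0 -> (x - a) * x' + (y - b) * y' = 0 by move=> ?; lra.
  exact: alg (derive_const (is_deriveB (is_derive_dot a b hx hy hx hy)
                                       (is_derive_lin a b hx hy)) h').
split=> //.
have := derive_const (is_derive_dot a b (smooth_derive u sx) (smooth_derive u sy)
  (smooth_derive2 u sx) (smooth_derive2 u sy)) D1.
by rewrite addrACA -!expr2.
Qed.

Let unit_tangent_eq c g u t (l : R) : 0 < l -> velocity c u = l *: velocity g t ->
  unit_tangent c u = unit_tangent g t.
Proof.
move=> l0 h; rewrite /unit_tangent h /= /GRing.scale /= !exprMn -mulrDr.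
rewrite sqrtrM ?sqr_ge0// sqrtr_sqr gtr0_norm//.
have l1 : l != 0 by rewrite gt_eqF.
by congr pair; rewrite /= /GRing.scale /= invfM mulrACA mulVf// mul1r.
Qed.

Let normal_decomp (x y e1 e2 : R) : e1 ^+ 2 + e2 ^+ 2 = 1 ->
  x * e1 + y * e2 = 0 ->
  exists2 m, x = m * - e2 & y = m * e1.
Proof.
move=> e xy; exists (y * e1 - x * e2).
  by rewrite -[LHS]mulr1 -e -[RHS]addr0 -(mul0r e1) -xy; ring.
by rewrite -[LHS]mulr1 -e -[RHS]addr0 -(mul0r e2) -xy; ring.
Qed.

Let trig_curve k a d b e a' d' b' e' : R -> R * R :=
  fun u => (trigf k a d b e u, trigf k a' d' b' e' u).

Let trig_velocity k a d b e a' d' b' e' u :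
  velocity (trig_curve k a d b e a' d' b' e') u =
  (trigf k d 0 (k * e) (- (k * b)) u, trigf k d' 0 (k * e') (- (k * b')) u).
Proof.
rewrite /velocity (_ : xcoord _ = trigf k a d b e)//.
by rewrite (_ : ycoord _ = trigf k a' d' b' e')// !trigf_derive.
Qed.

Let trig_acceleration k a d b e a' d' b' e' u :
  acceleration (trig_curve k a d b e a' d' b' e') u =
  (trigf k 0 0 (k * - (k * b)) (- (k * (k * e))) u,
   trigf k 0 0 (k * - (k * b')) (- (k * (k * e'))) u).
Proof.
rewrite /acceleration (_ : xcoord _ = trigf k a d b e)//.
by rewrite (_ : ycoord _ = trigf k a' d' b' e')// !derive1nS !derive1n0 !trigf_derive.
Qed.

Lemma osculating_circline_at_formula g t :
  regular_smooth_curve g -> osculating_circline_at g t (osculating_formula g t).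
Proof.
move=> gs; have v0 := let: And3 _ _ h := gs in h t.
have s0 := speed_gt0 v0; have := unit_tangent_sqr v0; have := velocityE v0.
rewrite /osculating_formula.
set k := signed_curvature g t; set s := speed g t in s0 *.
set e1 := (unit_tangent g t).1; set e2 := (unit_tangent g t).2.
move=> [w1 w2] e; have kE : signed_curvature g t = k by [].
clearbody k s e1 e2.
have vE : (e1, e2) = s^-1 *: velocity g t.
  by rewrite [velocity g t]surjective_pairing w1 w2; congr pair;
     rewrite /GRing.scale /= mulKf// gt_eqF.
have nz x y : x ^+ 2 + y ^+ 2 = 1 :> R -> (x, y) != 0.
  move=> xy; apply/eqP => -[x0 y0]; move: xy.
  by rewrite x0 y0 !expr0n/= addr0 => /esym/eqP; rewrite oner_eq0.
case: ifPn => k0; split.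
- right; exists (- e2), e1, (- e2 * (g t).1 + e1 * (g t).2); split.
    by apply: nz; rewrite sqrrN addrC.
  by apply/seteqP; split=> q /= => qS; lra.
- set c := trig_curve 0 (g t).1 e1 0 0 (g t).2 e2 0 0.
  have cv u : velocity c u = (e1, e2).
    by rewrite trig_velocity /trigf; congr pair; ring.
  have ca u : acceleration c u = (0, 0).
    by rewrite trig_acceleration /trigf; congr pair; ring.
  exists c, 0; split.
  + split; [exact: trigf_smooth|exact: trigf_smooth|].
    by move=> u; rewrite cv; exact: nz.
  + by move=> _ [u _ <-] /=; rewrite /trigf; ring.
  + by rewrite [RHS]surjective_pairing /c /trig_curve /trigf; congr pair; ring.
  + by exists s^-1; [rewrite invr_gt0|rewrite cv].
  + by rewrite kE (eqP k0) /signed_curvature ca /= !mulr0 subrr mul0r.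
- left; exists (g t + k^-1 *: (- e2, e1)), `|k|^-1; split.
    by rewrite invr_gt0 normr_gt0.
  by rewrite !exprVn real_normK ?num_real.
- set c := trig_curve k ((g t).1 - e2 / k) 0 (e2 / k) (e1 / k)
                        ((g t).2 + e1 / k) 0 (- e1 / k) (e2 / k).
  have cv u : velocity c u = (e1 * cos (k * u) - e2 * sin (k * u),
                              e2 * cos (k * u) + e1 * sin (k * u)).
    by rewrite trig_velocity /trigf; congr pair; field.
  have ca : acceleration c 0 = (- k * e2, k * e1).
    by rewrite trig_acceleration /trigf !mulr0 cos0 sin0; congr pair; field.
  have cv0 : velocity c 0 = (e1, e2).
    by rewrite cv !mulr0 cos0 sin0; congr pair; ring.
  exists c, 0; split.
  + split; [exact: trigf_smooth|exact: trigf_smooth|].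
    move=> u; rewrite cv; apply: nz.
    by rewrite -[RHS](cos2Dsin2 (k * u)) -[RHS]mul1r -e; ring.
  + move=> _ [u _ <-] /=; rewrite /trigf /GRing.scale /=.
    by rewrite -[RHS]mul1r -e -[RHS]mulr1 -(cos2Dsin2 (k * u)); field.
  + rewrite [RHS]surjective_pairing /c /trig_curve /trigf !mulr0 cos0 sin0.
    by congr pair; field.
  + by exists s^-1; [rewrite invr_gt0|rewrite cv0].
  + rewrite kE /signed_curvature cv0 ca /= e sqrtr1 expr1n divr1.
    by rewrite -[RHS]mulr1 -e; ring.
Qed.

Lemma osculating_circline_atE g t S : regular_smooth_curve g ->
  osculating_circline_at g t S <-> S = osculating_formula g t.
Proof.
move=> gs; split=> [[cS [c [u [cs cS' cu [l l0 vl] ck]]]]|->]; last first.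
  exact: osculating_circline_at_formula.
have v0 := let: And3 _ _ h := cs in h u.
have s0 := lt0r_neq0 (speed_gt0 v0).
have := curvature_num v0; have := unit_tangent_sqr v0; have := velocityE v0.
have s2 := speed_sqr c u.
have {}cS' s : S (c s) by apply: cS'; exists s.
have Sp : S (g t) by rewrite -cu.
rewrite ck /osculating_formula (unit_tangent_eq l0 vl).
set k := signed_curvature g t; set s := speed c u in s0 s2 *.
set e1 := (unit_tangent g t).1; set e2 := (unit_tangent g t).2.
move=> [w1 w2] e cross; clearbody k s e1 e2.
case: cS => [[z [r [r0 SE]]]|[a [b [d [ab SE]]]]].
- have h s' : ((c s').1 - z.1) ^+ 2 + ((c s').2 - z.2) ^+ 2 = r ^+ 2.
    by have := cS' s'; rewrite SE.
  have [h1 h2] := circle_contact u cs h.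
  rewrite cu -s2 w1 w2 in h1 h2.
  move: (acceleration c u).1 (acceleration c u).2 cross h2 => x y cross h2.
  have {}h1 : ((g t).1 - z.1) * e1 + ((g t).2 - z.2) * e2 = 0.
    by apply: (mulfI s0); rewrite mulr0 -h1; ring.
  have [m p1 p2] := normal_decomp e h1.
  have mk : m * k = - 1.
    have : s ^+ 2 + m * (e1 * y - e2 * x) = 0.
      by rewrite -h2 p1 p2; ring.
    by rewrite cross => ms; apply: (mulfI (expf_neq0 2 s0)); lra.
  have k0 : k != 0.
    by apply/eqP => k0; move/eqP: mk; rewrite k0 mulr0 eq_sym oppr_eq0 oner_eq0.
  have mE : m = - k^-1 by apply: (mulIf k0); rewrite mk mulNr mulVf.
  rewrite (negPf k0).
  have o1 : z.1 = (g t).1 + k^-1 * - e2.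
    by apply/eqP; rewrite -subr_eq0 -oppr_eq0 opprB addrAC p1 mE mulNr addNr.
  have o2 : z.2 = (g t).2 + k^-1 * e1.
    by apply/eqP; rewrite -subr_eq0 -oppr_eq0 opprB addrAC p2 mE mulNr addNr.
  have rk : r ^+ 2 = k^-1 ^+ 2.
    move: Sp; rewrite SE /= p1 p2 mE => <-.
    by rewrite -[RHS]mulr1 -e; ring.
  by rewrite SE rk o1 o2.
- have h s' : a * (c s').1 + b * (c s').2 = d by have := cS' s'; rewrite SE.
  have [h1 h2] := line_contact u cs h.
  rewrite w1 w2 in h1.
  move: (acceleration c u).1 (acceleration c u).2 cross h2 => x y cross h2.
  have {}h1 : a * e1 + b * e2 = 0.
    by apply: (mulfI s0); rewrite mulr0 -h1; ring.
  have [m aE bE] := normal_decomp e h1.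
  have m0 : m != 0.
    by apply: contra ab => /eqP m0; rewrite aE bE m0 !mul0r.
  have k0 : k = 0.
    apply: (mulIf (expf_neq0 2 s0)); apply: (mulfI m0).
    by rewrite -cross mul0r mulr0 -h2 aE bE; ring.
  rewrite k0 eqxx; have {}Sp : a * (g t).1 + b * (g t).2 = d.
    by move: Sp; rewrite SE.
  rewrite SE -Sp aE bE; apply/seteqP; split=> q /=.
    by move=> qS; apply: (mulfI m0); rewrite mulr0; lra.
  by move=> qS; apply/eqP; rewrite -subr_eq0 -[X in _ == X](mulr0 m) -qS; apply/eqP; ring.
Qed.

End Osculating.

(* Main.v *)
(* The winding number of the curve c about a point is locally constant off c,
   vanishes far away and jumps across c, so one side of c is outside, and the
   other one, where the winding number is nonzero, is inside. The largest
   disc inside c tangent to c at c(s) either osculates c there or touches c at a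
   second point c(t). Two such discs whose contact points
   interlace along c coincide. Hence, given contacts c(s) and c(t) of one disc,
   the disc touching c at the midpoint of the arc from s to t either osculates
   there or has a second contact on one of the two half arcs; bisection yields
   an osculating disc with contact strictly between s and t, and the
   complementary arc yields another one. For the circlines outside c, apply this
   to the image of c under an inversion centred inside c, which preserves
   circlines, contact orders and disjointness. If a point served both purposes,
   c would lie on its osculating circle, and then every point of c would do. *)

Require Import Defs.
From mathcomp Require Import all_boot all_order all_algebra.
From mathcomp Require Import all_classical all_reals all_analysis.
From mathcomp Require Import ring lra.
Import Order.TTheory GRing.Theory Num.Theory.
Import numFieldNormedType.Exports.
Local Open Scope ring_scope.
Local Open Scope classical_set_scope.

Set Implicit Arguments.
Unset Strict Implicit.
Unset Printing Implicit Defensive.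

(** * Calculus in one variable *)

Section Calculus.
Variable R : realType.
Implicit Types (f g F G : R -> R) (a b t : R).

(** The winding number is the increment of a primitive and is never shown to be an integer;
    increments about nearby points are compared through single-valued arctangents. Bisection by
    itself only yields contact pairs of one disc on ever shorter arcs. That an osculating inscribed
    disc results is proved by contradiction, since near a parameter without one such short pairs
    cannot exist. Bisection may also run into an end of the arc, which would spoil the distinctness
    of the two points, so it is started on a closed arc in the interior. After inversion about [z],
    the winding number at the image of [x] is that of [z] minus that of [x]; this exchanges the two
    sides of the curve. Circles and lines are handled together by the polynomial [osculating_form],
    whose sign along the curve expresses support. *)

Lemma is_derive_continuous f t (l : R) : is_derive t 1 f l -> {for t, continuous f}.
Proof. by move=> [df _]; exact/differentiable_continuous/derivable1_diffP. Qed.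

Lemma fun_continuousD (T : topologicalType) (f g : T -> R) (t : T) :
  {for t, continuous f} -> {for t, continuous g} ->
  {for t, continuous (fun s => f s + g s)}.
Proof. exact: continuousD. Qed.

Lemma fun_continuousB (T : topologicalType) (f g : T -> R) (t : T) :
  {for t, continuous f} -> {for t, continuous g} ->
  {for t, continuous (fun s => f s - g s)}.
Proof. exact: continuousB. Qed.

Lemma fun_continuousM (T : topologicalType) (f g : T -> R) (t : T) :
  {for t, continuous f} -> {for t, continuous g} ->
  {for t, continuous (fun s => f s * g s)}.
Proof. exact: continuousM. Qed.

Lemma fun_continuousV (T : topologicalType) (f : T -> R) (t : T) :
  {for t, continuous f} -> f t != 0 -> {for t, continuous (fun s => (f s)^-1)}.
Proof. by move=> cf f0; exact: continuousV. Qed.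

Lemma is_derive_unique f t (l m : R) : is_derive t 1 f l -> is_derive t 1 f m -> l = m.
Proof. by move=> [_ <-] [_ <-]. Qed.

Lemma mean_value f f' a b : a < b ->
  (forall t, a <= t <= b -> is_derive t 1 f (f' t)) ->
  exists2 t, a < t < b & f b - f a = f' t * (b - a).
Proof.
move=> ab df; have [||t] := @MVT R f f' a b ab.
- by move=> t; rewrite in_itv /= => /andP[at_ tb]; apply: df; rewrite !ltW.
- apply: derivable_within_continuous => t; rewrite in_itv /= => atb.
  by case: (df t atb).
- by rewrite in_itv /= => tab ->; exists t.
Qed.

Lemma mean_value_unordered f f' a b : a != b ->
  (forall t, is_derive t 1 f (f' t)) ->
  exists t, [/\ t != a, `|t - a| <= `|b - a| & f b - f a = f' t * (b - a)].
Proof.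
move=> anb df; have [ab|ba|ab] := ltgtP a b; last by rewrite ab eqxx in anb.
- have [t /andP[at_ tb] E] := mean_value ab (fun t _ => df t).
  exists t; split=> //; first by rewrite gt_eqF.
  by rewrite !ger0_norm ?subr_ge0 ?ltW//; lra.
- have [t /andP[bt ta] E] := mean_value ba (fun t _ => df t).
  exists t; split; first by rewrite lt_eqF.
    by rewrite !ler0_norm ?subr_le0 ?ltW//; lra.
  by rewrite -opprB E -mulrN opprB.
Qed.

Lemma taylor2 f f' f'' a b :
  (forall t, is_derive t 1 f (f' t)) -> (forall t, is_derive t 1 f' (f'' t)) ->
  exists2 t, `|t - a| <= `|b - a| &
    f b = f a + f' a * (b - a) + f'' t / 2 * (b - a) ^+ 2.
Proof.
move=> df ddf; have [->|anb] := eqVneq a b.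
  by exists b => //; rewrite subrr; ring.
have ba0 : b - a != 0 by rewrite subr_eq0 eq_sym.
(* [M] is chosen so that [g] takes the same value at [a] and [b]; the mean value theorem for [g],
   then for [g'], gives [f'' v = 2 * M]. Continuity of [f''] is not involved. *)
pose M := (f b - f a - f' a * (b - a)) / (b - a) ^+ 2.
have M1 : f b - f a - f' a * (b - a) = M * (b - a) ^+ 2.
  by rewrite /M divfK// expf_neq0.
pose g t := f t - f' a * (t - a) - M * (t - a) ^+ 2.
pose g' t := f' t - f' a - M * (2 * (t - a)).
have dg t : is_derive t 1 g (g' t).
  by rewrite /g; apply: is_derive_eq; rewrite /g' /GRing.scale /=; ring.
have dg' t : is_derive t 1 g' (f'' t - 2 * M).
  by rewrite /g'; apply: is_derive_eq; rewrite /GRing.scale /=; ring.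
have [t [ta tb E]] := mean_value_unordered anb dg.
have g't : g' t = 0.
  apply: (mulIf ba0); rewrite mul0r -E /g subrr; lra.
have at_ : a != t by rewrite eq_sym.
have [v [va vt E']] := mean_value_unordered at_ dg'.
exists v; first exact: le_trans vt tb.
have : (f'' v - 2 * M) * (t - a) = 0 by rewrite -E' g't /g' subrr; lra.
move/eqP; rewrite mulf_eq0 [t - a == 0]subr_eq0 (negPf ta) orbF => /eqP E2.
have -> : f'' v / 2 = M by lra.
lra.
Qed.

Lemma eq_increment F G f a b : a <= b ->
  (forall t, a <= t <= b -> is_derive t 1 F (f t)) ->
  (forall t, a <= t <= b -> is_derive t 1 G (f t)) ->
  F b - F a = G b - G a.
Proof.
rewrite le_eqVlt => /predU1P[->|ab] dF dG; first by rewrite !subrr.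
have [t tab|t tab E] := @mean_value (F \- G) (fun=> 0) a b ab.
  by have := dF t tab; have := dG t tab => ? ?; apply: is_derive_eq; rewrite subrr.
by move: E => /=; lra.
Qed.

Lemma clamp_continuous a b : continuous (fun t => Num.max a (Num.min b t)).
Proof.
move=> t; apply: continuous_max; first exact: cvg_cst.
by apply: continuous_min; [exact: cvg_cst|exact: cvg_id].
Qed.

Lemma continuous_primitive f a b : a <= b ->
  (forall t, a <= t <= b -> {for t, continuous f}) ->
  exists F, forall t, a <= t <= b -> is_derive t 1 F (f t).
Proof.
(* Clamping the argument to [[a, b]] extends [f] to a continuous function on the line; with the
   integral started at [a - 1], the primitive is differentiable at both end points too. *)
move=> ab cf; pose h t := f (Num.max a (Num.min b t)).
have ch : continuous h.
  move=> t; apply: (@continuous_comp _ _ _ (fun t => Num.max a (Num.min b t)) f).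
    exact: clamp_continuous.
  by apply: cf; rewrite le_max lexx /= ge_max ab /= ge_min lexx.
pose F x := (\int[lebesgue_measure]_(t in [set` Interval (BLeft (a - 1)) (BRight x)]) h t)%R.
exists F => t /andP[at_ tb].
have := @continuous_FTC1 R h (BLeft (a - 1)) t (b + 1) _ _ _ (ch t).
case.
- lra.
- apply: continuous_compact_integrable; first exact: segment_compact.
  exact: continuous_subspaceT.
- by rewrite lte_fin; lra.
- rewrite -/F derive1E => dF E; have -> : f t = 'D_1 F t.
    by rewrite E /h (min_idPr tb) (max_idPr at_).
  exact: DeriveDef.
Qed.

End Calculus.

(** * Variation of the argument along a path *)

Section Plane.
Variable R : realType.
Implicit Types (u v p q : R * R) (c d : R -> R * R) (a b t : R).

Definition dot u v : R := u.1 * v.1 + u.2 * v.2.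
Definition cross u v : R := u.1 * v.2 - u.2 * v.1.
Definition sq u : R := dot u u.
Definition perp u : R * R := (- u.2, u.1).

Lemma sq_ge0 u : 0 <= sq u.
Proof. by rewrite /sq /dot -!expr2 addr_ge0 ?sqr_ge0. Qed.

Lemma sq_eq0 u : (sq u == 0) = (u == 0).
Proof.
rewrite /sq /dot -!expr2 paddr_eq0 ?sqr_ge0// !sqrf_eq0.
by rewrite -[RHS]/((u.1 == 0) && (u.2 == 0)).
Qed.

Lemma sq_gt0 u : (0 < sq u) = (u != 0).
Proof. by rewrite lt_def sq_ge0 sq_eq0 andbT. Qed.

Lemma sqB_gt0 p q : p <> q -> 0 < sq (p - q).
Proof. by move=> /eqP pq; rewrite sq_gt0 subr_eq0. Qed.

Definition pderive c t v :=
  is_derive t 1 (fun t => (c t).1) v.1 /\ is_derive t 1 (fun t => (c t).2) v.2.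

Lemma pderiveB c v t q : pderive c t v -> pderive (fun t => c t - q) t v.
Proof.
by move=> [d1 d2]; split; apply: is_derive_eq => /=; rewrite ?subr0.
Qed.

Lemma is_derive_dot c d v w t : pderive c t v -> pderive d t w ->
  is_derive t 1 (fun t => dot (c t) (d t)) (dot v (d t) + dot (c t) w).
Proof.
move=> [? ?] [? ?]; rewrite /dot; apply: is_derive_eq.
by rewrite /GRing.scale /=; ring.
Qed.

Lemma is_derive_cross c d v w t : pderive c t v -> pderive d t w ->
  is_derive t 1 (fun t => cross (c t) (d t)) (cross v (d t) + cross (c t) w).
Proof.
move=> [? ?] [? ?]; rewrite /cross; apply: is_derive_eq.
by rewrite /GRing.scale /=; ring.
Qed.

Lemma is_derive_dotr c v w t : pderive c t v ->
  is_derive t 1 (fun t => dot (c t) w) (dot v w).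
Proof.
move=> cv; apply: is_derive_eq; first apply: (is_derive_dot cv (w := 0)).
  by split; exact: is_derive_cst.
by rewrite /dot /=; ring.
Qed.

Lemma is_derive_crossl c v w t : pderive c t v ->
  is_derive t 1 (fun t => cross w (c t)) (cross w v).
Proof.
move=> cv; apply: is_derive_eq; first apply: (is_derive_cross (v := 0) _ cv).
  by split; exact: is_derive_cst.
by rewrite /cross /=; ring.
Qed.

Lemma is_derive_dotl c v w t : pderive c t v ->
  is_derive t 1 (fun t => dot w (c t)) (dot w v).
Proof.
move=> cv; apply: is_derive_eq; first apply: (is_derive_dot (v := 0) _ cv).
  by split; exact: is_derive_cst.
by rewrite /dot /=; ring.
Qed.

Lemma is_derive_quot (f g : R -> R) (f' g' t : R) : g t != 0 ->
  is_derive t 1 f f' -> is_derive t 1 g g' ->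
  is_derive t 1 (fun t => f t / g t) ((f' * g t - f t * g') / g t ^+ 2).
Proof.
move=> g0 df dg; have dgV := is_deriveV g0 dg.
apply: is_derive_eq; rewrite /GRing.scale /=; field.
exact: g0.
Qed.

Lemma is_derive_atan_quot (f g : R -> R) (f' g' t : R) : g t != 0 ->
  is_derive t 1 f f' -> is_derive t 1 g g' ->
  is_derive t 1 (fun t => atan (f t / g t))
    ((f' * g t - f t * g') / (f t ^+ 2 + g t ^+ 2)).
Proof.
move=> g0 df dg; have dq := is_derive_quot g0 df dg.
have da := is_derive1_atan (f t / g t).
have dc : is_derive t 1 (fun t => atan (f t / g t)) _ :=
  @is_derive1_comp _ (@atan R) (fun t => f t / g t) _ _ _ da dq.
apply: (is_derive_eq dc).
have g2 : 0 < g t ^+ 2 by rewrite exprn_even_gt0.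
have h : f t ^+ 2 + g t ^+ 2 != 0 by rewrite gt_eqF// ltr_wpDl// sqr_ge0.
rewrite /=; field.
by rewrite g0 h.
Qed.

Definition C1path c d := [/\ forall t, pderive c t (d t),
  continuous (fun t => (d t).1) & continuous (fun t => (d t).2)].

(** The derivative of the argument of [c - q], that is, the angular 1-form about [q] pulled back
    along [c]. *)
Definition angle_form c d q t := cross (c t - q) (d t) / sq (c t - q).

(* Increment along [a, b] of a continuous determination of the argument of
   c - q; the junk value 0 is taken when no determination exists. *)
Definition angle c d q a b : R := xget 0 [set v | exists2 F,
  (forall t, a <= t <= b -> is_derive t 1 F (angle_form c d q t)) & v = F b - F a].

Lemma angleE c d q a b F : a <= b ->
  (forall t, a <= t <= b -> is_derive t 1 F (angle_form c d q t)) ->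
  angle c d q a b = F b - F a.
Proof.
move=> ab dF; rewrite /angle; case: xgetP => [v _ /= [G dG ->]|/(_ (F b - F a))].
  exact: eq_increment dG dF.
by case; exists F.
Qed.

Lemma angle_primitive c d q a b : C1path c d -> a <= b ->
  (forall t, a <= t <= b -> c t <> q) ->
  exists F, forall t, a <= t <= b -> is_derive t 1 F (angle_form c d q t).
Proof.
move=> [cd d1 d2] ab cq; apply: continuous_primitive => // t tab.
have [c1 c2] := cd t.
have {}c1 := is_derive_continuous c1; have {}c2 := is_derive_continuous c2.
have cq0 := cq t tab; have {}d1 := d1 t; have {}d2 := d2 t.
have cB (k : R -> R) (r : R) : {for t, continuous k} ->
    {for t, continuous (fun t => k t - r)}.
  by move=> ck; apply: (fun_continuousB ck); exact: cvg_cst.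
have {}c1 := cB _ q.1 c1; have {}c2 := cB _ q.2 c2.
have cS : {for t, continuous (fun t => sq (c t - q))} :=
  fun_continuousD (fun_continuousM c1 c1) (fun_continuousM c2 c2).
have cC : {for t, continuous (fun t => cross (c t - q) (d t))} :=
  fun_continuousB (fun_continuousM c1 d2) (fun_continuousM c2 d1).
by apply: (fun_continuousM cC (fun_continuousV cS _)); rewrite gt_eqF// sqB_gt0.
Qed.

Lemma angle_cat c d q a b e : C1path c d -> a <= b -> b <= e ->
  (forall t, a <= t <= e -> c t <> q) ->
  angle c d q a e = angle c d q a b + angle c d q b e.
Proof.
move=> cd ab be cq; have ae := le_trans ab be.
have [F dF] := angle_primitive cd ae cq.
have dab t : a <= t <= b -> is_derive t 1 F (angle_form c d q t).
  by move=> /andP[at_ tb]; apply: dF; rewrite at_ (le_trans tb).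
have dbe t : b <= t <= e -> is_derive t 1 F (angle_form c d q t).
  by move=> /andP[bt te]; apply: dF; rewrite te (le_trans ab).
by rewrite (angleE ae dF) (angleE ab dab) (angleE be dbe); ring.
Qed.

(* As long as the dot product is positive this is the angle from p - q to
   p - q'; comparing the arguments seen from two nearby points through it makes
   winding numbers locally constant without knowing that they are integers. *)
Definition arg_between q q' p : R := atan (cross (p - q) (p - q') / dot (p - q) (p - q')).

(** The argument of [p - q] measured from the direction [v], valid in the half-plane where
    [dot v (p - q)] is positive. *)
Definition arg_from v q p : R := atan (cross v (p - q) / dot v (p - q)).

Let lagrange_cross u v : cross u v ^+ 2 + dot u v ^+ 2 = sq u * sq v.
Proof. by rewrite /cross /dot /sq /dot; ring. Qed.

Lemma dot_gt0_neq0 u v : 0 < dot u v -> 0 < sq u /\ 0 < sq v.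
Proof.
move=> uv; rewrite !sq_gt0.
by split; apply/eqP => E; move: uv; rewrite E /dot /= ?mul0r ?mulr0 addr0 ltxx.
Qed.

Lemma angle_sub c d q q' a b : C1path c d -> a <= b ->
  (forall t, a <= t <= b -> 0 < dot (c t - q) (c t - q')) ->
  angle c d q' a b - angle c d q a b =
  arg_between q q' (c b) - arg_between q q' (c a).
Proof.
move=> cd ab h.
have hq t : a <= t <= b -> c t <> q.
  move=> /h/dot_gt0_neq0[+ _]; rewrite sq_gt0 subr_eq0 => /eqP; exact.
have hq' t : a <= t <= b -> c t <> q'.
  move=> /h/dot_gt0_neq0[_]; rewrite sq_gt0 subr_eq0 => /eqP; exact.
have [F dF] := angle_primitive cd ab hq.
have [G dG] := angle_primitive cd ab hq'.
rewrite (angleE ab dF) (angleE ab dG).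
transitivity ((G \- F) b - (G \- F) a); first by rewrite /=; ring.
apply: (@eq_increment _ _ (fun t => arg_between q q' (c t))
  (fun t => angle_form c d q' t - angle_form c d q t)) => // t tab.
  by have := dF _ tab; have := dG _ tab => ? ?; exact: is_deriveB.
have [cdt _ _] := cd; have dq := pderiveB q (cdt t); have dq' := pderiveB q' (cdt t).
rewrite /arg_between; apply: is_derive_eq.
  apply: is_derive_atan_quot; first by rewrite gt_eqF//; exact: h.
    exact: is_derive_cross dq dq'.
  exact: is_derive_dot dq dq'.
have [/lt0r_neq0 + /lt0r_neq0] := dot_gt0_neq0 (h _ tab).
rewrite lagrange_cross /angle_form.
move: (c t - q) (c t - q') (d t) => [x y] [z w] [k l].
rewrite /cross /sq /dot /= => h1 h2; field.
by rewrite h1 h2.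
Qed.

Lemma angle_halfplane c d q v a b : C1path c d -> a <= b ->
  (forall t, a <= t <= b -> 0 < dot v (c t - q)) ->
  angle c d q a b = arg_from v q (c b) - arg_from v q (c a).
Proof.
move=> cd ab h; apply: (angleE (F := fun t => arg_from v q (c t))) => // t tab.
have [cdt _ _] := cd; have dq := pderiveB q (cdt t).
rewrite /arg_from; apply: is_derive_eq.
  apply: is_derive_atan_quot; first by rewrite gt_eqF//; exact: h.
    exact: is_derive_crossl dq.
  exact: is_derive_dotl dq.
have [/lt0r_neq0 + /lt0r_neq0] := dot_gt0_neq0 (h _ tab).
rewrite lagrange_cross /angle_form.
move: (c t - q) (d t) => [x y] [k l]; case: v {h} => v1 v2.
rewrite /cross /sq /dot /= => h1 h2; field.
by rewrite h1 h2.
Qed.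

End Plane.

(** * Topology of the plane: connected sets and outside points *)

Section PlaneTopology.
Variable R : realType.
Implicit Types (q v : R * R) (c d : R -> R * R) (X G : set (R * R)).

Lemma pair_continuous (T : topologicalType) (f g : T -> R) (t : T) :
  {for t, continuous f} -> {for t, continuous g} ->
  {for t, continuous (fun t => (f t, g t))}.
Proof.
by move=> cf cg; apply: (@cvg_pair _ _ _ (nbhs t) (nbhs (f t)) (nbhs (g t))).
Qed.

Lemma plane_nbhs_box X q : nbhs q X <->
  exists2 r : R, 0 < r & forall q', `|q'.1 - q.1| < r -> `|q'.2 - q.2| < r -> X q'.
Proof.
rewrite -nbhs_ballE; split=> -[r /= r0 rX]; exists r => // q'.
  by move=> h1 h2; apply: rX; split; rewrite -ball_normE /ball_ /= distrC.
case; rewrite -!ball_normE /ball_ /= => h1 h2.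
by apply: rX; rewrite distrC.
Qed.

Lemma locally_constant_connected (T : Type) X (h : R * R -> T) : connected X ->
  (forall q, X q -> exists2 r : R, 0 < r &
     forall q', X q' -> `|q'.1 - q.1| < r -> `|q'.2 - q.2| < r -> h q' = h q) ->
  forall q q', X q -> X q' -> h q = h q'.
Proof.
move=> cX hX q q' Xq Xq'.
(* Every union of level sets of [h] is relatively open in [X], so each level set is also relatively
   closed. *)
have op (P : set T) : exists2 C, open C & [set p | X p /\ P (h p)] = X `&` C.
  exists (interior [set p | X p -> P (h p)]); first exact: open_interior.
  apply/seteqP; split=> p /= [Xp]; last by move=> /interior_subset /(_ Xp).
  move=> Pp; split=> //; apply/plane_nbhs_box.
  have [r r0 hr] := hX p Xp; exists r => // p' h1 h2 Xp'.
  by rewrite hr.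
have /= E : [set p | X p /\ h p = h q] = X.
  apply: cX; first by exists q.
    exact: (op [set z | z = h q]).
  have [C oC CE] := op [set z | z <> h q].
  exists (~` C); first exact: open_closedC.
  apply/seteqP; split=> p /= [Xp hp]; split=> //.
    by move=> Cp; have [] : [set p | X p /\ h p <> h q] p by rewrite CE.
  apply: contrapT => np; have [_] : (X `&` C) p by rewrite -CE.
  exact: hp.
by have [] : [set p | X p /\ h p = h q] q' by rewrite E.
Qed.

Lemma path_connected c (A : set R) : connected A ->
  (forall t, {for t, continuous c}) -> connected (c @` A).
Proof.
move=> cA cc; apply: connected_continuous_connected => //.
exact: continuous_subspaceT.
Qed.

Lemma affine_continuous q v (t : R) :
  {for t, continuous (fun t : R => (q.1 + t * v.1, q.2 + t * v.2))}.
Proof.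
apply: pair_continuous; apply: fun_continuousD; try exact: cvg_cst;
  by apply: fun_continuousM; [exact: cvg_id|exact: cvg_cst].
Qed.

Lemma plane_segment_connected q q' :
  connected [set (q.1 + t * (q' - q).1, q.2 + t * (q' - q).2) | t in `[0, 1 : R]].
Proof.
apply: path_connected; last exact: affine_continuous.
exact/connected_intervalP/interval_is_interval.
Qed.

Lemma boundedP X : bounded_set X <->
  exists B : R, forall q, X q -> `|q.1| <= B /\ `|q.2| <= B.
Proof.
split=> [[M [_ XM]]|[B XB]].
  exists (M + 1) => q Xq; have := XM (M + 1) _ q Xq.
  by rewrite ltrDl ltr01 /= prod_normE ge_max => /(_ isT)/andP[].
exists B; split; first exact: num_real.
move=> M BM q /XB[q1 q2]; rewrite /= prod_normE ge_max.
by rewrite !(le_trans _ (ltW BM)).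
Qed.

Lemma outside_connected G X q q' : connected X -> X `<=` ~` G -> X q -> X q' ->
  outside G q -> outside G q'.
Proof.
move=> cX XG Xq Xq' [Gq bq]; split; first exact: XG.
suff -> : connected_component (~` G) q' = connected_component (~` G) q by [].
by apply: same_connected_component; exists X.
Qed.

(** The ray is an unbounded connected subset of the complement. Together with [outside_connected]
    this is how points are recognized as outside, without any knowledge of the components. *)
Lemma outside_ray G q v : v != 0 ->
  (forall t : R, 0 <= t -> ~ G (q.1 + t * v.1, q.2 + t * v.2)) -> outside G q.
Proof.
move=> v0 qG; pose X := [set (q.1 + t * v.1, q.2 + t * v.2) | t in `[0, +oo[%classic : set R].
have cX : connected X.
  apply: path_connected; last exact: affine_continuous.
  exact/connected_intervalP/interval_is_interval.
have Xq : X q.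
  by exists 0; [rewrite /= in_itv /= lexx|rewrite !mul0r !addr0 -surjective_pairing].
have XG : X `<=` ~` G.
  by move=> _ [t /= + <-]; rewrite in_itv /= andbT; exact: qG.
split; first exact: XG.
move/boundedP => [B HB].
have XC := connected_component_max Xq XG cX.
have H t : 0 <= t -> `|q.1 + t * v.1| <= B /\ `|q.2 + t * v.2| <= B.
  move=> t0; apply: (HB (q.1 + t * v.1, q.2 + t * v.2)); apply: XC.
  by exists t => //=; rewrite in_itv /= andbT.
have lin (x y : R) : (forall t, 0 <= t -> `|x + t * y| <= B) -> y = 0.
  move=> xy; apply: contrapT => /eqP y0.
  have B0 : 0 <= B by apply: le_trans (xy 0 (lexx _)).
  have := xy ((B + `|x| + 1) / `|y|) _.
  rewrite divr_ge0 ?addr_ge0// => /(_ isT).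
  apply/negP; rewrite -ltNge.
  have : `|(B + `|x| + 1) / `|y| * y| = B + `|x| + 1.
    rewrite normrM normf_div normr_id divfK ?normr_eq0// ger0_norm//.
    by rewrite !addr_ge0.
  move: ((B + `|x| + 1) / `|y| * y) => z zE.
  have : `|z| <= `|x + z| + `|x|.
    by have := ler_normB (x + z) x; rewrite addrAC subrr add0r.
  lra.
have v1 : v.1 = 0 by apply: (lin q.1) => t /H[].
have v2 : v.2 = 0 by apply: (lin q.2) => t /H[].
by move/eqP: v0; apply; rewrite [v]surjective_pairing v1 v2.
Qed.

End PlaneTopology.

(** * Winding number of a closed curve *)

Section Periodic.
Variable R : realType.

Lemma periodic_int (T : Type) (f : R -> T) (L : R) : (forall t, f (t + L) = f t) ->
  forall (n : int) t, f (t + n%:~R * L) = f t.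
Proof.
move=> fL; have fn (n : nat) t : f (t + n%:R * L) = f t.
  elim: n t => [|n IHn] t; first by rewrite mul0r addr0.
  by rewrite -natr1 mulrDl mul1r addrA fL.
move=> [n|n] t; first exact: fn.
by rewrite NegzE mulrNz mulNr -[LHS](fn n.+1) subrK.
Qed.

Lemma periodic_window (L s t : R) : 0 < L ->
  exists2 n : int, s <= t + n%:~R * L & t + n%:~R * L < s + L.
Proof.
move=> L0; have := floor_itv ((t - s) / L); rewrite intrD1.
have : t - s = (t - s) / L * L by rewrite divfK// gt_eqF.
move: ((t - s) / L) => x xE; move: (Num.floor x) => n /andP[].
rewrite -(ler_pM2r L0) -(ltr_pM2r L0) => h1 h2.
by exists (- n); rewrite mulrNz; lra.
Qed.

Lemma periodic_bounded (f : R -> R) (L : R) : 0 < L -> continuous f ->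
  (forall t, f (t + L) = f t) -> exists B, forall t, `|f t| <= B.
Proof.
move=> L0 cf fL; have L0' := ltW L0.
have cw : {within `[0, L], continuous (fun t => `|f t|)}.
  apply: continuous_subspaceT => t.
  exact: (@continuous_comp _ _ _ f (fun x : R => `|x|) t (cf t) (@norm_continuous _ _ _)).
have [m _ mM] := EVT_max L0' cw; exists `|f m| => t.
have [n n1 n2] := periodic_window 0 t L0.
rewrite -(periodic_int fL n t); apply: mM.
by rewrite in_itv /= n1 ltW // -[X in _ < X]add0r.
Qed.

End Periodic.

Section Winding.
Variable R : realType.
Implicit Types (q v : R * R) (c d e : R -> R * R) (X G : set (R * R)).

(** Two continuous derivatives are kept and named explicitly, so that the reversed and the inverted
    curve only require formulas for these two. Simplicity is stated for arbitrary pairs less than a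
    period apart, so that parameters need not be reduced to one period. *)
Record closed_curve c d e (L : R) : Prop := ClosedCurve {
  closed_deriv : forall t, pderive c t (d t);
  closed_deriv2 : forall t, pderive d t (e t);
  closed_cont1 : continuous (fun t => (e t).1);
  closed_cont2 : continuous (fun t => (e t).2);
  closed_length : 0 < L;
  closed_period : forall t, c (t + L) = c t;
  closed_simple : forall t u, t < u -> u < t + L -> c t <> c u;
  closed_regular : forall t, d t <> 0 }.

Lemma pderive_continuous c t v : pderive c t v ->
  {for t, continuous (fun t => (c t).1)} /\ {for t, continuous (fun t => (c t).2)}.
Proof. by move=> [c1 c2]; split; exact: is_derive_continuous. Qed.

Lemma sq_continuous c t q : {for t, continuous (fun t => (c t).1)} ->
  {for t, continuous (fun t => (c t).2)} -> {for t, continuous (fun t => sq (c t - q))}.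
Proof.
move=> c1 c2.
have cB (k : R -> R) (r : R) : {for t, continuous k} -> {for t, continuous (fun t => k t - r)}.
  by move=> ck; apply: (fun_continuousB ck); exact: cvg_cst.
have {}c1 := cB _ q.1 c1; have {}c2 := cB _ q.2 c2.
exact: (fun_continuousD (fun_continuousM c1 c1) (fun_continuousM c2 c2)).
Qed.

Lemma path_distance c d q (a b : R) : C1path c d -> a <= b ->
  (forall t, a <= t <= b -> c t <> q) ->
  exists2 r : R, 0 < r & forall t, a <= t <= b -> r <= sq (c t - q).
Proof.
move=> [cd _ _] ab cq.
have [|m mab mM] := @EVT_min R (fun t => sq (c t - q)) a b ab.
  apply: continuous_subspaceT => t.
  by have [c1 c2] := pderive_continuous (cd t); exact: sq_continuous.
exists (sq (c m - q)); first by apply/sqB_gt0/cq; rewrite in_itv /= in mab.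
by move=> t tab; apply: mM; rewrite in_itv.
Qed.

Lemma dot_near c q (P : R -> Prop) (m : R) : 0 < m ->
  (forall t, P t -> m <= sq (c t - q)) ->
  exists2 r : R, 0 < r & forall q', `|q'.1 - q.1| < r -> `|q'.2 - q.2| < r ->
    forall t, P t -> 0 < dot (c t - q) (c t - q').
Proof.
(* By polarization [2 * dot (c t - q) (c t - q')] equals [sq (c t - q) + sq (c t - q') - sq (q -
   q')], and the radius keeps [sq (q - q')] below [m]. *)
move=> m0 mP; exists (Num.min 1 (m / 2)); first by rewrite lt_min ltr01 divr_gt0.
have small (x : R) : `|x| < Num.min 1 (m / 2) -> x ^+ 2 < m / 2.
  rewrite lt_min => /andP[x1 x2]; rewrite -real_normK ?num_real// expr2.
  by apply: le_lt_trans x2; rewrite ler_piMr// ltW.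
move=> q' /small h1 /small h2 t /mP; rewrite /sq /dot /=.
move: (c t).1 (c t).2 q.1 q.2 q'.1 q'.2 h1 h2 => x y a b a' b' h1 h2 h.
have := sqr_ge0 (x - a'); have := sqr_ge0 (y - b'); lra.
Qed.

Lemma far_halfplane (B : R) (x : R * R) : 0 < B -> ~ (`|x.1| <= B /\ `|x.2| <= B) ->
  exists v, forall q, `|q.1| <= B -> `|q.2| <= B -> 0 < dot v (q - x).
Proof.
move=> B0 xB.
have far (z y : R) : ~~ (`|z| <= B) -> `|y| <= B -> 0 < - Num.sg z * (y - z).
  rewrite -ltNge => zB; rewrite ler_norml => /andP[y1 y2].
  have [z0|z0|z0] := ltgtP z 0.
  - by rewrite ltr0_sg// opprK mul1r; rewrite ltr0_norm// in zB; lra.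
  - by rewrite gtr0_sg//; rewrite gtr0_norm// in zB; lra.
  - by move: zB; rewrite z0 normr0; lra.
have [x1|x1] := boolP (`|x.1| <= B); last first.
  by exists (- Num.sg x.1, 0) => q q1 _; rewrite /dot /= mul0r addr0; exact: far.
exists (0, - Num.sg x.2) => q _ q2; rewrite /dot /= mul0r add0r; apply: far => //.
by apply/negP => x2; apply: xB.
Qed.

(** The net increment of the argument over a period, hence 2π times the usual winding number. *)
Definition winding c d (L : R) q := angle c d q 0 L.

Section OneCurve.
Variables (c d e : R -> R * R) (L : R).
Hypothesis cc : closed_curve c d e L.

Lemma closed_C1path : C1path c d.
Proof.
split; first exact: closed_deriv cc.
  by move=> t; have [] := pderive_continuous (closed_deriv2 cc t).
by move=> t; have [] := pderive_continuous (closed_deriv2 cc t).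
Qed.

Let L0 := closed_length cc.

Lemma pderive_period (f f' : R -> R * R) : (forall t, pderive f t (f' t)) ->
  (forall t, f (t + L) = f t) -> forall t, f' (t + L) = f' t.
Proof.
move=> ff' fL t; have [h1 h2] := ff' (t + L); have [k1 k2] := ff' t.
have shift (g : R -> R) l : is_derive (t + L) 1 g l -> is_derive t 1 (fun t => g (t + L)) l.
  move=> hg; have hs : is_derive t 1 (fun t => t + L) 1.
    by apply: is_derive_eq; rewrite addr0.
  by rewrite -[l]mulr1; exact: (@is_derive1_comp _ g (fun t => t + L) _ _ _ hg hs).
rewrite [LHS]surjective_pairing [RHS]surjective_pairing; congr pair.
  apply: is_derive_unique (shift _ _ h1) _.
  by under eq_fun do rewrite fL.
apply: is_derive_unique (shift _ _ h2) _.
by under eq_fun do rewrite fL.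
Qed.

Lemma closed_period1 t : d (t + L) = d t.
Proof. exact: pderive_period (closed_deriv cc) (closed_period cc) t. Qed.

Lemma closed_period2 t : e (t + L) = e t.
Proof. exact: pderive_period (closed_deriv2 cc) closed_period1 t. Qed.

Lemma closed_window s t :
  exists u, [/\ s <= u, u < s + L, c u = c t, d u = d t & e u = e t].
Proof.
have [n n1 n2] := periodic_window s t L0; exists (t + n%:~R * L); split=> //.
- exact: periodic_int (closed_period cc) n t.
- exact: periodic_int closed_period1 n t.
- exact: periodic_int closed_period2 n t.
Qed.

Lemma closed_bounded : exists2 B, 0 < B & forall t,
  [/\ `|(c t).1| <= B, `|(c t).2| <= B, `|(d t).1| <= B, `|(d t).2| <= B
    & `|(e t).1| <= B /\ `|(e t).2| <= B].
Proof.
have bnd (f : R -> R * R) : continuous (fun t => (f t).1) ->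
    continuous (fun t => (f t).2) -> (forall t, f (t + L) = f t) ->
    exists B, forall t, `|(f t).1| <= B /\ `|(f t).2| <= B.
  move=> f1 f2 fL.
  have [|B hB] := periodic_bounded L0 f1; first by move=> t; rewrite fL.
  have [|B' hB'] := periodic_bounded L0 f2; first by move=> t; rewrite fL.
  by exists (Num.max B B') => t; rewrite !le_max hB hB' orbT.
have cont (f f' : R -> R * R) : (forall t, pderive f t (f' t)) -> continuous (fun t => (f t).1) /\
    continuous (fun t => (f t).2).
  by move=> ff'; split=> t; have [] := pderive_continuous (ff' t).
have [c1 c2] := cont _ _ (closed_deriv cc); have [d1 d2] := cont _ _ (closed_deriv2 cc).
have [B hB] := bnd _ c1 c2 (closed_period cc).
have [B' hB'] := bnd _ d1 d2 closed_period1.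
have [B'' hB''] := bnd _ (closed_cont1 cc) (closed_cont2 cc) closed_period2.
exists (Num.max 1 (Num.max B (Num.max B' B''))); first by rewrite lt_max ltr01.
move=> t; have [b1 b2] := hB t; have [b1' b2'] := hB' t; have [b1'' b2''] := hB'' t.
by split; rewrite ?le_max ?b1 ?b2 ?b1' ?b2' ?b1'' ?b2'' ?orbT//.
Qed.

Lemma off_curve q t : ~ range c q -> c t <> q.
Proof. by move=> h E; apply: h; exists t. Qed.

Lemma curve_distance q : ~ range c q ->
  exists2 r : R, 0 < r & forall t, r <= sq (c t - q).
Proof.
move=> cq.
have [|r r0 hr] := path_distance closed_C1path (ltW L0) (q := q).
  by move=> t _; exact: off_curve.
exists r => // t; have [u [u0 uL <- _ _]] := closed_window 0 t.
by apply: hr; rewrite u0 ltW// -[X in _ < X]add0r.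
Qed.

(** A primitive of the angle form and its translate by [L] have the same derivative, so the
    increment over a period does not depend on where the period starts. *)
Lemma winding_shift q a : ~ range c q -> angle c d q a (a + L) = winding c d L q.
Proof.
move=> cq; have L0' := ltW L0.
have main lo hi : lo <= hi -> angle c d q lo (lo + L) = angle c d q hi (hi + L).
  move=> lohi.
  have [||F dF] := @angle_primitive _ c d q lo (hi + L) closed_C1path; first by lra.
    by move=> t _; exact: off_curve.
  have dF1 t : lo <= t <= lo + L -> is_derive t 1 F (angle_form c d q t).
    by move=> /andP[? ?]; apply: dF; lra.
  have dF2 t : hi <= t <= hi + L -> is_derive t 1 F (angle_form c d q t).
    by move=> /andP[? ?]; apply: dF; lra.
  have loL : lo <= lo + L by lra.
  have hiL : hi <= hi + L by lra.
  rewrite (angleE loL dF1) (angleE hiL dF2).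
  have dF3 t : lo <= t <= hi -> is_derive t 1 F (angle_form c d q t).
    by move=> /andP[? ?]; apply: dF; lra.
  have dF4 t : lo <= t <= hi -> is_derive t 1 (fun t => F (t + L)) (angle_form c d q t).
    move=> /andP[? ?]; have hF : is_derive (t + L) 1 F (angle_form c d q (t + L)).
      by apply: dF; lra.
    have hs : is_derive t 1 (fun t => t + L) 1.
      by apply: is_derive_eq; rewrite addr0.
    have -> : angle_form c d q t = angle_form c d q (t + L) * 1.
      by rewrite /angle_form (closed_period cc) closed_period1 mulr1.
    exact: (@is_derive1_comp _ F (fun t => t + L) _ _ _ hF hs).
  have := eq_increment lohi dF3 dF4; lra.
rewrite /winding -[X in _ = angle _ _ _ _ X](add0r L).
by have [/main->|/ltW/main->] := leP a 0.
Qed.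

Lemma winding_eq q q' : (forall t, 0 < dot (c t - q) (c t - q')) ->
  winding c d L q' = winding c d L q.
Proof.
move=> h; apply/eqP; rewrite -subr_eq0; apply/eqP.
rewrite (angle_sub closed_C1path (ltW L0)) => [|t _]; last exact: h.
by rewrite -[L]add0r (closed_period cc) subrr.
Qed.

Lemma winding_halfplane q v : (forall t, 0 < dot v (c t - q)) -> winding c d L q = 0.
Proof.
move=> h; rewrite /winding (angle_halfplane (v := v) closed_C1path (ltW L0)) => [|t _].
  by rewrite -[L]add0r (closed_period cc) subrr.
exact: h.
Qed.

Lemma winding_connected X q q' : connected X -> X `<=` ~` range c -> X q -> X q' ->
  winding c d L q = winding c d L q'.
Proof.
move=> cX XG; apply: (locally_constant_connected cX) => {q q'} q Xq.
have [m m0 hm] := curve_distance (XG q Xq).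
have [r r0 hr] := dot_near (P := fun _ => True) m0 (fun t _ => hm t).
exists r => // q' _ h1 h2; apply: winding_eq => t; exact: hr.
Qed.

Lemma winding_segment q q' :
  (forall t : R, 0 <= t <= 1 ->
     ~ range c (q.1 + t * (q' - q).1, q.2 + t * (q' - q).2)) ->
  winding c d L q = winding c d L q'.
Proof.
move=> h; have cX := @plane_segment_connected R q q'.
apply: (winding_connected cX).
- by move=> _ [t /= + <-]; rewrite in_itv /=; exact: h.
- exists 0; first by rewrite /= in_itv /= lexx ler01.
  by rewrite !mul0r !addr0 -surjective_pairing.
- exists 1; first by rewrite /= in_itv /= lexx ler01.
  by rewrite !mul1r /= addrC subrK addrC subrK -surjective_pairing.
Qed.

Lemma winding_bounded : exists2 B, 0 < B & forall q,
  winding c d L q <> 0 -> `|q.1| <= B /\ `|q.2| <= B.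
Proof.
have [B B0 hB] := closed_bounded; exists B => // q w0.
apply: contrapT => qB; apply: w0; have [v hv] := far_halfplane B0 qB.
by apply: (winding_halfplane (v := v)) => t; have [c1 c2 _ _ _] := hB t; exact: hv.
Qed.

(** [winding] is constant on the component of [q] and vanishes off a box, so the component stays in
    that box. *)
Lemma winding_inside q : ~ range c q -> winding c d L q <> 0 -> inside (range c) q.
Proof.
move=> cq w0; split=> //; apply/boundedP.
have [B _ hB] := winding_bounded; exists B => q' Cq'; apply: hB.
have qC : connected_component (~` range c) q q by exact: connected_component_refl.
rewrite -(winding_connected (component_connected (A := _) (x := q)) _ qC Cq') //.
exact: connected_component_sub.
Qed.

Lemma winding_outside q : outside (range c) q -> winding c d L q = 0.
Proof.
move=> [cq bq]; apply: contrapT => w0; apply: bq.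
by have [] := winding_inside cq w0.
Qed.

End OneCurve.
End Winding.

(** * Tubular neighbourhood and orientation *)

Section Tube.
Variable R : realType.
Implicit Types (q v w : R * R) (c d e : R -> R * R).

Lemma dot_perp_self v : dot v (perp v) = 0.
Proof. by rewrite /dot /perp /=; ring. Qed.

Lemma sq_perp v : sq (perp v) = sq v.
Proof. by rewrite /sq /dot /perp /=; ring. Qed.

Lemma dot_sqr_le v w : dot v w ^+ 2 <= sq v * sq w.
Proof.
have := sqr_ge0 (cross v w); rewrite /sq /dot /cross; move: v w => [x y] [z t] /=; lra.
Qed.

Lemma dot_norm_le (B : R) v w : 0 < B -> `|v.1| <= B -> `|v.2| <= B ->
  `|w.1| <= B -> `|w.2| <= B -> `|dot v w| <= 2 * B ^+ 2.
Proof.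
move=> B0 v1 v2 w1 w2; apply: le_trans (ler_normD _ _) _; rewrite !normrM.
have -> : 2 * B ^+ 2 = B * B + B * B by ring.
by apply: lerD; apply: ler_pM.
Qed.

Lemma continuous_dotr c t w : {for t, continuous (fun t => (c t).1)} ->
  {for t, continuous (fun t => (c t).2)} -> {for t, continuous (fun t => dot (c t) w)}.
Proof.
move=> c1 c2; have cw (k : R) : {for t, continuous (fun _ : R => k)} by exact: cvg_cst.
exact: (fun_continuousD (fun_continuousM c1 (cw w.1)) (fun_continuousM c2 (cw w.2))).
Qed.

Lemma global_max_derive (f f' : R -> R) (t : R) :
  (forall u : R, is_derive u 1 f (f' u)) -> (forall u, f u <= f t) -> f' t = 0.
Proof.
move=> df h; have d0 : is_derive t 1 f 0.
  have ab : t - 1 <= t + 1 by lra.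
  apply: (derive1_at_max ab) => [u _||u _]; last exact: h.
    by have [] := df u.
  by rewrite in_itv /=; apply/andP; split; lra.
exact: is_derive_unique (df t) d0.
Qed.

Definition normal_point c d (s a : R) : R * R :=
  ((c s).1 - a * (d s).2, (c s).2 + a * (d s).1).

Section OneCurve.
Variables (c d e : R -> R * R) (L : R).
Hypothesis cc : closed_curve c d e L.
Let L0 := closed_length cc.

Lemma curve_taylor s u w : exists t,
  dot (c u - c s) w = (u - s) * dot (d s) w + (u - s) ^+ 2 * (dot (e t) w / 2).
Proof.
have [t|t|t _] := @taylor2 R (fun u => dot (c u - c s) w) (fun u => dot (d u) w)
  (fun u => dot (e u) w) s u.
- by apply: is_derive_dotr; apply: pderiveB; exact: closed_deriv cc t.
- by apply: is_derive_dotr; exact: closed_deriv2 cc t.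
move=> ->; exists t; rewrite subrr.
have -> : dot 0 w = 0 by rewrite /dot /= !mul0r addr0.
by ring.
Qed.

Lemma second_order_bound : exists2 C : R, 0 < C & forall s u,
  `|dot (c u - c s) (perp (d s))| <= C * (u - s) ^+ 2 /\
  `|dot (c u - c s) (d s) - (u - s) * sq (d s)| <= C * (u - s) ^+ 2.
Proof.
have [B B0 hB] := closed_bounded cc; exists (B ^+ 2); first by rewrite exprn_gt0.
move=> s u.
have est w : `|w.1| <= B -> `|w.2| <= B ->
    `|dot (c u - c s) w - (u - s) * dot (d s) w| <= B ^+ 2 * (u - s) ^+ 2.
  move=> w1 w2; have [t ->] := curve_taylor s u w.
  rewrite addrAC subrr add0r normrM mulrC [`|(u - s) ^+ 2|]ger0_norm ?sqr_ge0//.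
  apply: ler_wpM2r; first exact: sqr_ge0.
  have [_ _ _ _ [e1 e2]] := hB t.
  rewrite normrM [`|2^-1|]ger0_norm ?invr_ge0// ler_pdivrMr// mulrC.
  exact: dot_norm_le.
have [_ _ d1 d2 _] := hB s; split; last exact: est.
rewrite -[X in `|X|]subr0 -(mulr0 (u - s)) -(dot_perp_self (d s)).
by apply: est; rewrite ?normrN.
Qed.

Lemma speed_bound : exists2 m : R, 0 < m & forall s, m <= sq (d s).
Proof.
have [|m _ mM] := @EVT_min R (fun t => sq (d t - 0)) 0 L (ltW L0).
  apply: continuous_subspaceT => t.
  by have [c1 c2] := pderive_continuous (closed_deriv2 cc t); exact: sq_continuous.
exists (sq (d m - 0)); first exact/sqB_gt0/(closed_regular cc).
move=> t; have [u [u0 uL _ <- _]] := closed_window cc 0 t.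
by rewrite -[X in _ <= sq X]subr0; apply: mM; rewrite in_itv /= u0 ltW// -[X in _ < X]add0r.
Qed.

Lemma far_chord_bound (h : R) : 0 < h -> h <= L / 2 -> exists2 m : R, 0 < m &
  forall s u, h <= u - s -> u - s <= L / 2 -> m <= sq (c u - c s).
Proof.
move=> h0 hL.
(* The coordinates are the starting parameter and the parameter difference. Keeping the difference
   between [h] and [L / 2], short of a full period, excludes coincident points on the compact
   rectangle. *)
pose K := `[0, L]%classic `*` `[h, L / 2]%classic : set (R * R).
have cK : compact K by apply: compact_setX; exact: segment_compact.
pose f (z : R * R) := sq (c (z.1 + z.2) - c z.1).
have cf : continuous f.
  have [cx cy] : continuous (fun t => (c t).1) /\ continuous (fun t => (c t).2).
    by split=> t; have [] := pderive_continuous (closed_deriv cc t).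
  move=> z.
  have cadd : {for z, continuous (fun z : R * R => z.1 + z.2)}.
    by apply: fun_continuousD; [exact: cvg_fst|exact: cvg_snd].
  have c1 (g : R -> R) : continuous g -> {for z, continuous (fun z : R * R => g (z.1 + z.2) - g z.1)}.
    move=> cg; apply: fun_continuousB.
      exact: (@continuous_comp _ _ _ (fun z : R * R => z.1 + z.2) g z cadd (cg _)).
    exact: (@continuous_comp _ _ _ (fun z : R * R => z.1) g z cvg_fst (cg _)).
  have h1 := c1 _ cx; have h2 := c1 _ cy.
  exact: (fun_continuousD (fun_continuousM h1 h1) (fun_continuousM h2 h2)).
have [||z zK zM] := @compact_EVT_min _ R f K _ cK.
- by exists (0, h); split; rewrite /= in_itv /= lexx //= ltW.
- exact: continuous_subspaceT.
rewrite inE in zK; have [/=] := zK; rewrite !in_itv /= => /andP[z1 z2] /andP[z3 z4].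
exists (f z).
  by apply: sqB_gt0 => /esym; apply: (closed_simple cc); lra.
move=> s u su1 su2; have [n n1 n2] := periodic_window 0 s L0.
rewrite add0r in n2.
have -> : sq (c u - c s) = f (s + n%:~R * L, u - s).
  rewrite /f /= (_ : s + n%:~R * L + (u - s) = u + n%:~R * L); last by ring.
  by rewrite !(periodic_int (closed_period cc)).
by apply: zM; rewrite inE; split; rewrite /= in_itv /= ?n1 ?su1 ?su2 ?ltW.
Qed.

(** On short arcs the first-order Taylor term dominates, on longer ones compactness gives a bound.
    Differences up to [L / 2] cover all pairs of points by periodicity. *)
Lemma chord_arc : exists2 m : R, 0 < m &
  forall s u, `|u - s| <= L / 2 -> m * (u - s) ^+ 2 <= sq (c u - c s).
Proof.
have [C C0 hC] := second_order_bound; have [v v0 hv] := speed_bound.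
have [B B0 hB] := closed_bounded cc.
(* For differences up to [h] the quadratic error is at most half of the linear term. *)
pose h := Num.min (L / 2) (v / (2 * C)).
have h0 : 0 < h by rewrite lt_min !divr_gt0// mulr_gt0.
have hL : h <= L / 2 by rewrite ge_min lexx.
have hv2 : C * h <= v / 2.
  have : h <= v / (2 * C) by rewrite ge_min lexx orbT.
  by rewrite ler_pdivlMr ?mulr_gt0//; lra.
have [m m0 hm] := far_chord_bound h0 hL.
(* The constant comes from [|D| >= |u - s| * v / 2] and Cauchy-Schwarz, [D ^+ 2 <= S * sq (d s) <= S
   * (2 * B ^+ 2)]. *)
have near s u : `|u - s| <= h -> v ^+ 2 / (8 * B ^+ 2) * (u - s) ^+ 2 <= sq (c u - c s).
  move=> ush; have [_ h2] := hC s u; have vs := hv s.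
  have dB : sq (d s) <= 2 * B ^+ 2.
    have [_ _ d1 d2 _] := hB s.
    by apply: le_trans (ler_norm _) _; exact: dot_norm_le.
  have cs := dot_sqr_le (c u - c s) (d s).
  set D := dot _ _ in h2 cs; set S := sq (c u - c s) in cs *.
  have S0 : 0 <= S := sq_ge0 _.
  have low : `|u - s| * (v / 2) <= `|D|.
    have t1 : `|u - s| * v <= `|(u - s) * sq (d s)|.
      by rewrite normrM ler_wpM2l// (le_trans vs)// ler_norm.
    have t2 : C * (u - s) ^+ 2 <= `|u - s| * (v / 2).
      rewrite -real_normK ?num_real// expr2 mulrCA ler_wpM2l//.
      by apply: le_trans hv2; rewrite ler_wpM2l// ltW.
    have := ler_normB (D - (u - s) * sq (d s)) D.
    have -> : D - (u - s) * sq (d s) - D = - ((u - s) * sq (d s)) by ring.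
    rewrite normrN; lra.
  have low2 : (u - s) ^+ 2 * (v / 2) ^+ 2 <= D ^+ 2.
    rewrite -[X in X * _ <= _]real_normK ?num_real// -exprMn -[X in _ <= X]real_normK ?num_real//.
    by rewrite ler_sqr ?nnegrE// mulr_ge0// divr_ge0// ltW.
  have up : D ^+ 2 <= S * (2 * B ^+ 2) by apply: le_trans cs _; rewrite ler_wpM2l.
  have B8 : 0 < 8 * B ^+ 2 by rewrite mulr_gt0// exprn_gt0.
  by rewrite mulrAC ler_pdivrMr//; lra.
have far s u : h <= u - s -> u - s <= L / 2 -> m / L ^+ 2 * (u - s) ^+ 2 <= sq (c u - c s).
  move=> h1 h2; apply: le_trans (hm s u h1 h2).
  rewrite mulrAC ler_pdivrMr ?exprn_gt0// ler_wpM2l ?(ltW m0)// ler_sqr ?nnegrE; lra.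
exists (Num.min (v ^+ 2 / (8 * B ^+ 2)) (m / L ^+ 2)).
  by rewrite lt_min !divr_gt0// ?exprn_gt0// mulr_gt0// exprn_gt0.
have sqC (x y : R * R) : sq (x - y) = sq (y - x) by rewrite /sq /dot /=; ring.
move=> s u usL; have [ush|hus] := leP `|u - s| h.
  apply: le_trans (near s u ush); apply: ler_wpM2r; first exact: sqr_ge0.
  by rewrite ge_min lexx.
apply: (@le_trans _ _ (m / L ^+ 2 * (u - s) ^+ 2)).
  by apply: ler_wpM2r; [exact: sqr_ge0|rewrite ge_min lexx orbT].
have [us|us] := leP 0 (u - s).
  by move: hus usL; rewrite ger0_norm// => /ltW + ?; move/far; exact.
move: hus usL; rewrite ltr0_norm// opprB => /ltW + ? => /far.
by rewrite sqC (_ : (s - u) ^+ 2 = (u - s) ^+ 2); [exact|ring].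
Qed.

(** The quadratic bound on the normal component is divided by the chord-arc inequality. Up to
    scaling, this bounds the curvatures of all circles that touch the curve and meet it again. *)
Lemma normal_bound : exists2 K : R, 0 < K & forall s u,
  `|dot (c u - c s) (perp (d s))| <= K * sq (c u - c s).
Proof.
have [C C0 hC] := second_order_bound; have [m m0 hm] := chord_arc.
exists (C / m); first by rewrite divr_gt0.
move=> s u; have [t [t1 t2 <- _ _]] := closed_window cc (s - L / 2) u.
have [h1 _] := hC s t; apply: le_trans h1 _.
rewrite -mulrA ler_wpM2l ?(ltW C0)// ler_pdivlMl//; apply: hm.
by rewrite ler_norml; apply/andP; split; lra.
Qed.

(** If the normal point at parameter [a] were on the curve, [normal_bound] would read
    [|a| <= K * a ^+ 2] after division by [sq (d s)]. *)
Lemma tube_off_curve : exists2 r : R, 0 < r & forall s a, a != 0 -> `|a| < r ->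
  ~ range c (normal_point c d s a).
Proof.
have [K K0 hK] := normal_bound; exists K^-1; first by rewrite invr_gt0.
move=> s a a0 aK [u _ E]; have := hK s u.
have -> : c u - c s = a *: perp (d s).
  rewrite E /normal_point /perp [c s]surjective_pairing; congr pair;
    by rewrite /GRing.scale /=; ring.
have v0 : 0 < sq (d s) by rewrite sq_gt0; apply/eqP; exact: closed_regular cc s.
have -> : dot (a *: perp (d s)) (perp (d s)) = a * sq (d s).
  by rewrite /sq /dot /perp /= /GRing.scale /=; ring.
have -> : sq (a *: perp (d s)) = `|a| ^+ 2 * sq (d s).
  by rewrite real_normK ?num_real// /sq /dot /perp /= /GRing.scale /=; ring.
have na : 0 < `|a| by rewrite normr_gt0.
rewrite normrM (gtr0_norm v0) mulrA ler_pM2r// expr2 mulrA ler_pMl//.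
rewrite -[K^-1]mul1r ltr_pdivlMr// in aK; lra.
Qed.

End OneCurve.
End Tube.

Section Orientation.
Variable R : realType.
Implicit Types (q v w : R * R) (c d e : R -> R * R).

Lemma atan_quot_gt0 (x y : R) : 0 < x -> 0 < y -> 0 < atan (x / y).
Proof. by move=> x0 y0; rewrite -atan0; apply: lt_atan; rewrite divr_gt0. Qed.

Lemma atan_quot_lt0 (x y : R) : x < 0 -> 0 < y -> atan (x / y) < 0.
Proof.
move=> x0 y0; rewrite -atan0; apply: lt_atan.
by rewrite ltr_pdivrMr// mul0r.
Qed.

Section Jump.
Variables (c d e : R -> R * R) (L : R).
Hypothesis cc : closed_curve c d e L.
Let L0 := closed_length cc.
Let w := winding c d L.

(* Near c s the curve lies in a half-plane as seen from either point, and away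
   from c s it is seen from both of them within a right angle; the arctangents
   that add up to the jump all have the same sign. *)
Lemma winding_jump (r s : R) : 0 < r ->
  exists a, [/\ 0 < a, a < r & w (normal_point c d s (- a)) < w (normal_point c d s a)].
Proof.
move=> r0; have [r1 r10 tube] := tube_off_curve cc.
have [C C0 hC] := second_order_bound cc; have [m m0 hm] := chord_arc cc.
have v0 : 0 < sq (d s) by rewrite sq_gt0; apply/eqP; exact: closed_regular cc s.
set v := sq (d s) in v0.
(* Here [h] is the half-width of the near arc and [a = k * h]. The bound on [k] puts the far arc
   outside the circle with diameter from [xn] to [xp]. The bounds on [h] keep the near arc between
   the parallels to the tangent through these two points, give [al] opposite signs at the two ends
   of the near arc, and keep [a] below [r] and [r1]. *)
pose k := Num.min 1 (m / (2 * v)).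
have k0 : 0 < k by rewrite lt_min ltr01 divr_gt0// mulr_gt0.
have kv : k ^+ 2 * v < m.
  have k1 : k <= 1 by rewrite ge_min lexx.
  have : k <= m / (2 * v) by rewrite ge_min lexx orbT.
  rewrite ler_pdivlMr ?mulr_gt0// => k2.
  have : k ^+ 2 * v <= k * v by rewrite ler_pM2r// expr2 ger_pMl.
  lra.
pose h := Num.min (L / 2) (Num.min (k * v / (2 * C))
  (Num.min (v / (2 * C)) (Num.min r r1 / (2 * k)))).
have h0 : 0 < h.
  by rewrite !lt_min !divr_gt0 ?mulr_gt0// lt_min r0.
have [hL h2 h3 h4] : [/\ h <= L / 2, h <= k * v / (2 * C), h <= v / (2 * C) &
    h <= Num.min r r1 / (2 * k)] by split; rewrite !ge_min lexx ?orbT.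
rewrite ler_pdivlMr ?mulr_gt0// in h2.
rewrite ler_pdivlMr ?mulr_gt0// in h3.
rewrite ler_pdivlMr ?mulr_gt0// in h4.
pose a := k * h.
have a0 : 0 < a by rewrite mulr_gt0.
have [ar ar1] : a < r /\ a < r1.
  have : 2 * a <= Num.min r r1 by rewrite /a; lra.
  by rewrite le_min => /andP[? ?]; split; lra.
exists a; split=> //.
set xp := normal_point c d s a; set xn := normal_point c d s (- a).
have Gp : ~ range c xp by apply: tube; rewrite ?gt_eqF// gtr0_norm.
have Gn : ~ range c xn by apply: tube; rewrite ?oppr_eq0 ?gt_eqF// normrN gtr0_norm.
pose al u := dot (c u - c s) (d s); pose be u := dot (c u - c s) (perp (d s)).
have dot1 u : dot (- perp (d s)) (c u - xp) = a * v - be u.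
  by rewrite /be /xp /v /dot /sq /dot /perp /normal_point /=; ring.
have cross1 u : cross (- perp (d s)) (c u - xp) = al u.
  by rewrite /al /xp /cross /dot /perp /normal_point /=; ring.
have dot2 u : dot (perp (d s)) (c u - xn) = a * v + be u.
  by rewrite /be /xn /v /dot /sq /dot /perp /normal_point /=; ring.
have cross2 u : cross (perp (d s)) (c u - xn) = - al u.
  by rewrite /al /xn /cross /dot /perp /normal_point /=; ring.
have dot3 u : dot (c u - xn) (c u - xp) = sq (c u - c s) - a ^+ 2 * v.
  by rewrite /xn /xp /v /sq /dot /perp /normal_point /=; ring.
have cross3 u : cross (c u - xn) (c u - xp) = - (2 * a * al u).
  by rewrite /al /xn /xp /cross /dot /normal_point /=; ring.
have near u : s - h <= u <= s + h -> `|be u| < a * v.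
  move=> /andP[u1 u2]; have [+ _] := hC s u; move/le_lt_trans; apply.
  have ush : `|u - s| <= h.
    by clear -u1 u2; rewrite ler_norml; apply/andP; split; lra.
  have : (u - s) ^+ 2 <= h ^+ 2.
    by rewrite -[X in X <= _]real_normK ?num_real// ler_sqr ?nnegrE// ltW.
  rewrite -(ler_pM2l C0) => ?.
  have : h * (h * (2 * C)) <= h * (k * v) by rewrite ler_pM2l.
  have : 0 < h * (k * v) by rewrite !mulr_gt0.
  rewrite /a; lra.
have far u : s + h <= u <= s - h + L -> 0 < dot (c u - xn) (c u - xp).
  rewrite dot3 subr_gt0 => /andP[u1 u2].
  have low u' : h <= `|u' - s| -> `|u' - s| <= L / 2 -> a ^+ 2 * v < sq (c u' - c s).
    move=> us1 us2; apply: lt_le_trans (hm s u' us2).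
    have : h ^+ 2 <= (u' - s) ^+ 2.
      by rewrite -[X in _ <= X]real_normK ?num_real// ler_sqr ?nnegrE// ltW.
    rewrite -(ler_pM2l m0); apply: lt_le_trans.
    by rewrite /a exprMn mulrAC ltr_pM2r// exprn_gt0.
  have [us|us] := leP (u - s) (L / 2).
    by apply: low; clear -u1 us h0; rewrite ger0_norm; lra.
  have -> : c u = c (u - L) by rewrite -[in LHS](subrK L u) (closed_period cc).
  by apply: low; clear -u2 us h0 hL; rewrite ler0_norm; lra.
have C1 := closed_C1path cc.
have lohi : s - h <= s + h by clear -h0; lra.
have hilo : s + h <= s - h + L by clear -hL; lra.
have wE q : ~ range c q ->
    w q = angle c d q (s - h) (s + h) + angle c d q (s + h) (s - h + L).
  move=> Gq; rewrite -(angle_cat C1 lohi hilo); last by move=> t _; exact: off_curve.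
  by rewrite (winding_shift cc).
have np u : s - h <= u <= s + h -> 0 < dot (- perp (d s)) (c u - xp).
  by move=> /near; rewrite dot1 ltr_norml subr_gt0 => /andP[].
have nn u : s - h <= u <= s + h -> 0 < dot (perp (d s)) (c u - xn).
  by move=> /near; rewrite dot2 ltr_norml => /andP[h1 _]; clear -h1; lra.
have farE := angle_sub C1 hilo far; rewrite (closed_period cc) in farE.
rewrite (wE _ Gp) (wE _ Gn) (angle_halfplane C1 lohi np) (angle_halfplane C1 lohi nn).
move: farE; rewrite /arg_from /arg_between !dot1 !cross1 !dot2 !cross2 !dot3 !cross3.
have elo : s - h <= s - h <= s + h by rewrite lexx lohi.
have ehi : s - h <= s + h <= s + h by rewrite lexx lohi.
have [p1 p2] := (np _ elo, np _ ehi); have [n1 n2] := (nn _ elo, nn _ ehi).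
rewrite !dot1 in p1 p2; rewrite !dot2 in n1 n2.
have f1 := far (s + h); have f2 := far (s - h + L).
rewrite dot3 in f1; rewrite dot3 (closed_period cc) in f2.
have {}f1 : 0 < sq (c (s + h) - c s) - a ^+ 2 * v by apply: f1; rewrite lexx hilo.
have {}f2 : 0 < sq (c (s - h) - c s) - a ^+ 2 * v by apply: f2; rewrite lexx hilo.
have vh : C * h ^+ 2 < h * v.
  have : h * (h * (2 * C)) <= h * v by rewrite ler_pM2l.
  have : 0 < h * v by rewrite mulr_gt0.
  lra.
have alp : 0 < al (s + h).
  have [_] := hC s (s + h); rewrite -/(al _) -/v (_ : s + h - s = h); last by ring.
  by clear -vh; rewrite ler_norml => /andP[? ?]; lra.
have aln : al (s - h) < 0.
  have [_] := hC s (s - h); rewrite -/(al _) -/v (_ : s - h - s = - h); last by ring.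
  rewrite sqrrN.
  by clear -vh; rewrite ler_norml => /andP[? ?]; lra.
have A x y : atan (- x / y) = - atan (x / y) by rewrite mulNr atanN.
rewrite !A.
have al2p : 0 < 2 * a * al (s + h) by rewrite !mulr_gt0.
have al2n : 2 * a * al (s - h) < 0 by rewrite pmulr_rlt0// mulr_gt0.
have := atan_quot_gt0 alp p2; have := atan_quot_gt0 alp n2.
have := atan_quot_lt0 aln p1; have := atan_quot_lt0 aln n1.
have := atan_quot_gt0 al2p f1; have := atan_quot_lt0 al2n f2.
clear; lra.
Qed.

End Jump.

(* The normals perp (d s) point inwards. *)
Definition positively_oriented c d (L : R) := exists r W : R, [/\ 0 < r, W != 0 &
  forall s a, 0 < a -> a < r -> [/\ ~ range c (normal_point c d s a),
    winding c d L (normal_point c d s a) = W &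
    outside (range c) (normal_point c d s (- a))]].

Lemma real_line_connected : connected [set: R].
Proof. by apply/connected_intervalP. Qed.

(** At the highest point the right-hand normal points lie above the whole curve, and a vertical ray
    shows them to be outside. Each parallel curve is connected and misses [c], which carries this to
    all parameters and makes the winding number constant on the left; [winding_jump] makes that
    constant nonzero. *)
Lemma positively_oriented_at_top c d e (L s0 : R) : closed_curve c d e L ->
  (forall u, (c u).2 <= (c s0).2) -> (d s0).1 < 0 -> positively_oriented c d L.
Proof.
move=> cc top d0; have [r r0 tube] := tube_off_curve cc.
have [cx cy] : continuous (fun t => (c t).1) /\ continuous (fun t => (c t).2).
  by split=> t; have [] := pderive_continuous (closed_deriv cc t).
have [dx dy] : continuous (fun t => (d t).1) /\ continuous (fun t => (d t).2).
  by split=> t; have [] := pderive_continuous (closed_deriv2 cc t).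
pose X a := range (fun s => normal_point c d s a).
have cX a : connected (X a).
  apply: path_connected; first exact: real_line_connected.
  move=> t; apply: pair_continuous.
    apply: fun_continuousB; first exact: cx.
    by apply: fun_continuousM; [exact: cvg_cst|exact: dy].
  apply: fun_continuousD; first exact: cy.
  by apply: fun_continuousM; [exact: cvg_cst|exact: dx].
have XG a : a != 0 -> `|a| < r -> X a `<=` ~` range c.
  by move=> a0 ar _ [s _ <-]; exact: tube.
have Xs a s : X a (normal_point c d s a) by exists s.
have out s a : 0 < a -> a < r -> outside (range c) (normal_point c d s (- a)).
  move=> a0 ar.
  have aN : - a != 0 by rewrite oppr_eq0 gt_eqF.
  have aNr : `|- a| < r by rewrite normrN gtr0_norm.
  apply: (outside_connected (cX (- a)) (XG _ aN aNr) (Xs _ s0) (Xs _ s)).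
  apply: (@outside_ray _ _ _ (0, 1)).
    by apply/eqP => -[/eqP]; rewrite oner_eq0.
  move=> t t0 [u _ E]; have := top u; rewrite E /=.
  have : 0 < a * - (d s0).1 by rewrite mulr_gt0// oppr_gt0.
  lra.
have wc s s' a a' : 0 < a -> a < r -> 0 < a' -> a' < r ->
    winding c d L (normal_point c d s a) = winding c d L (normal_point c d s' a').
  move=> a0 ar a'0 a'r.
  have nz b : 0 < b -> b < r -> b != 0 /\ `|b| < r.
    by move=> b0 br; rewrite gt_eqF// gtr0_norm.
  have [n1 n2] := nz _ a0 ar.
  rewrite (winding_connected cc (cX a) (XG _ n1 n2) (Xs _ s) (Xs _ s')).
  pose Y := normal_point c d s' @` `]0, r[%classic.
  apply: (winding_connected cc (X := Y)).
  - apply: path_connected; first exact/connected_intervalP/interval_is_interval.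
    move=> t; apply: pair_continuous.
      by apply: fun_continuousB; [exact: cvg_cst|apply: fun_continuousM;
        [exact: cvg_id|exact: cvg_cst]].
    by apply: fun_continuousD; [exact: cvg_cst|apply: fun_continuousM;
      [exact: cvg_id|exact: cvg_cst]].
  - move=> _ [b /= + <-]; rewrite in_itv /= => /andP[b0 br].
    by have [? ?] := nz _ b0 br; exact: tube.
  - by exists a => //=; rewrite in_itv /= a0.
  - by exists a' => //=; rewrite in_itv /= a'0.
have [a [a0 ar jump]] := winding_jump cc 0 r0.
exists r, (winding c d L (normal_point c d 0 a)); split=> //.
  by move: jump; rewrite (winding_outside cc (out _ _ a0 ar)) => /gt_eqF ->.
move=> s b b0 br; split; last exact: out.
  by apply: tube; rewrite ?gt_eqF// gtr0_norm.
exact: wc.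
Qed.

Lemma closed_curve_reverse c d e (L : R) : closed_curve c d e L ->
  closed_curve (fun t => c (- t)) (fun t => - d (- t)) (fun t => e (- t)) L.
Proof.
move=> cc.
have rev (f : R -> R) (l t : R) : is_derive (- t) 1 f l -> is_derive t 1 (fun t => f (- t)) (- l).
  move=> df; rewrite -mulrN1.
  exact: (@is_derive1_comp _ f (fun t => - t) _ _ _ df (is_deriveNid _ _)).
have crev (f : R -> R) : continuous f -> continuous (fun t => f (- t)).
  move=> cf t; apply: (@continuous_comp _ _ _ (fun t : R => - t) f); last exact: cf.
  exact: opp_continuous.
split.
- by move=> t; have [h1 h2] := closed_deriv cc (- t); split; exact: rev.
- move=> t; have [h1 h2] := closed_deriv2 cc (- t).
  have {}h1 := is_deriveN (rev _ _ _ h1); have {}h2 := is_deriveN (rev _ _ _ h2).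
  by split; [apply: (is_derive_eq h1)|apply: (is_derive_eq h2)]; rewrite opprK.
- exact: crev (closed_cont1 cc).
- exact: crev (closed_cont2 cc).
- exact: closed_length cc.
- by move=> t; rewrite -(closed_period cc (- (t + L))) opprD addrNK.
- move=> t u tu uL; apply/nesym; apply: (closed_simple cc); lra.
- by move=> t /eqP; rewrite oppr_eq0 => /eqP; exact: closed_regular cc _.
Qed.

Lemma range_reverse c : range (fun t => c (- t)) = range c.
Proof.
apply/seteqP; split=> _ [t _ <-]; first by exists (- t).
by exists (- t) => //; rewrite opprK.
Qed.

Lemma orientation c d e (L : R) : closed_curve c d e L ->
  positively_oriented c d L \/
  positively_oriented (fun t => c (- t)) (fun t => - d (- t)) L.
Proof.
move=> cc.
have [|s0 _ s0M] := @EVT_max R (fun t => (c t).2) 0 L (ltW (closed_length cc)).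
  apply: continuous_subspaceT => t.
  by have [] := pderive_continuous (closed_deriv cc t).
have top u : (c u).2 <= (c s0).2.
  have [t [t0 tL <- _ _]] := closed_window cc 0 u.
  by apply: s0M; rewrite in_itv /= t0 ltW// -[X in _ < X]add0r.
have d2 : (d s0).2 = 0.
  apply: (@global_max_derive R (fun t => (c t).2) (fun t => (d t).2)) => // u.
  by have [] := closed_deriv cc u.
have [d1|d1|d1] := ltgtP (d s0).1 0.
- by left; exact: positively_oriented_at_top cc top d1.
- right; apply: (positively_oriented_at_top (s0 := - s0) (closed_curve_reverse cc)).
    by move=> u; rewrite opprK; exact: top.
  by rewrite opprK /= oppr_lt0.
- exfalso; apply: (closed_regular cc (t := s0)).
  by rewrite [LHS]surjective_pairing d1 d2.
Qed.

End Orientation.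

(** * Discs inscribed in a closed curve *)

Section Inscribed.
Variable R : realType.
Implicit Types (q o v : R * R) (c d e : R -> R * R) (s t u : R).

(* Up to a positive factor, the equation of the circline having second order
   contact with c at the parameter s. *)
Definition osculating_form c d e (s : R) q : R :=
  dot (e s) (perp (d s)) * sq (q - c s) - 2 * sq (d s) * dot (q - c s) (perp (d s)).

Definition nearest c o (s : R) := forall u, sq (c s - o) <= sq (c u - o).

(* Lying inside c is expressed by a nonzero winding number. *)
Definition medial c d (L : R) o := ~ range c o /\ winding c d L o <> 0.

Definition bitangent c d (L s t : R) :=
  exists o, [/\ medial c d L o, nearest c o s & nearest c o t].

Section OneCurve.
Variables (c d e : R -> R * R) (L : R).
Hypotheses (cc : closed_curve c d e L) (pos : positively_oriented c d L).
Let L0 := closed_length cc.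
Let w := winding c d L.
Let N s := perp (d s).

Lemma speed_gt0 s : 0 < sq (d s).
Proof. by rewrite sq_gt0; apply/eqP; exact: closed_regular cc s. Qed.

Lemma is_derive_sqB o u :
  is_derive u 1 (fun u => sq (c u - o)) (2 * dot (d u) (c u - o)).
Proof.
have dq := pderiveB o (closed_deriv cc u).
apply: is_derive_eq; first exact: (is_derive_dot dq dq).
by rewrite /dot; ring.
Qed.

Lemma nearest_critical o s : nearest c o s -> dot (d s) (c s - o) = 0.
Proof.
move=> no.
suff : - (2 * dot (d s) (c s - o)) = 0 by lra.
apply: (@global_max_derive R (fun u => - sq (c u - o)) (fun u => - (2 * dot (d u) (c u - o)))).
  by move=> u; have h := is_derive_sqB o u; exact: is_deriveN.
by move=> u; rewrite lerN2.
Qed.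

Lemma nearest_ball o s q : nearest c o s -> sq (q - o) < sq (c s - o) -> ~ range c q.
Proof. by move=> no h [u _ E]; have := no u; rewrite E leNgt h. Qed.

(** Only the end [q] can lie on the bounding circle; the rest of the segment is in the open disc,
    which the curve avoids. Admitting the bounding circle is what later places the osculating circle
    itself on one side. *)
Lemma nearest_segment o s q t : nearest c o s -> ~ range c o -> ~ range c q ->
  sq (q - o) <= sq (c s - o) -> 0 <= t <= 1 ->
  ~ range c (q.1 + t * (o - q).1, q.2 + t * (o - q).2).
Proof.
move=> no Go Gq qo /andP[t0 t1].
have [->|tn0] := eqVneq t 0; first by rewrite !mul0r !addr0 -surjective_pairing.
apply: (nearest_ball no).
have -> : sq ((q.1 + t * (o - q).1, q.2 + t * (o - q).2) - o) = (1 - t) ^+ 2 * sq (q - o).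
  by rewrite /sq /dot /=; ring.
have cs0 : 0 < sq (c s - o) by apply/sqB_gt0/off_curve.
apply: (@le_lt_trans _ _ ((1 - t) ^+ 2 * sq (c s - o))).
  by rewrite ler_wpM2l// sqr_ge0.
rewrite gtr_pMl// expr_lt1 ?subr_ge0//.
by have : 0 < t by [rewrite lt_def tn0 t0]; lra.
Qed.

Lemma nearest_winding o s q : nearest c o s -> ~ range c o -> ~ range c q ->
  sq (q - o) <= sq (c s - o) -> w q = w o.
Proof.
by move=> no Go Gq qo; apply: (winding_segment cc) => t; exact: nearest_segment no Go Gq qo.
Qed.

(** The critical point equation puts [o] on the normal line. On its right-hand half the disc about
    [o] would contain a right-hand normal point near [c s], which is outside, and [o] would have
    winding number 0. *)
Lemma medial_center o s : medial c d L o -> nearest c o s ->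
  exists2 a, 0 < a & o = normal_point c d s a.
Proof.
move=> [Go wo] no; have crit := nearest_critical no; have v0 := speed_gt0 s.
pose a := dot (o - c s) (N s) / sq (d s).
have oE : o = normal_point c d s a.
  have h : dot (d s) (c s - o) / sq (d s) = 0 by rewrite crit mul0r.
  have v1 : sq (d s) / sq (d s) = 1 by rewrite divff// gt_eqF.
  rewrite [LHS]surjective_pairing /normal_point /a; congr pair.
    transitivity ((c s).1 + (o.1 - (c s).1) * (sq (d s) / sq (d s))); first by rewrite v1; ring.
    rewrite -[RHS]addr0 -[X in _ = _ + X](mulr0 (- (d s).1)) -h.
    by rewrite /sq /dot /N /perp /=; ring.
  transitivity ((c s).2 + (o.2 - (c s).2) * (sq (d s) / sq (d s))); first by rewrite v1; ring.
  rewrite -[RHS]addr0 -[X in _ = _ + X](mulr0 (- (d s).2)) -h.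
  by rewrite /sq /dot /N /perp /=; ring.
exists a => //; rewrite ltNge; apply/negP => a0.
have {}a0 : a < 0.
  rewrite lt_neqAle a0 andbT; apply/eqP => a0'; apply: Go; exists s => //.
  by rewrite oE a0' /normal_point !mul0r subr0 addr0 -surjective_pairing.
have [r [W [r0 _ posr]]] := pos.
pose b := Num.min (r / 2) (- a).
have [b0 br ba] : [/\ 0 < b, b < r & b <= - a].
  have b1 : b <= r / 2 by rewrite ge_min lexx.
  by split; [rewrite lt_min divr_gt0// oppr_gt0|lra|rewrite ge_min lexx orbT].
have [_ _ out] := posr s b b0 br.
apply: wo; rewrite -(winding_outside cc out); apply/esym.
apply: (nearest_winding no) => //; first by case: out.
rewrite oE.
have -> : sq (normal_point c d s (- b) - normal_point c d s a) = (- a - b) ^+ 2 * sq (d s).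
  by rewrite /sq /dot /normal_point /=; ring.
have -> : sq (c s - normal_point c d s a) = (- a) ^+ 2 * sq (d s).
  by rewrite /sq /dot /normal_point /=; ring.
rewrite ler_pM2r// ler_sqr ?nnegrE; lra.
Qed.

Lemma nearest_normalP s a : nearest c (normal_point c d s a) s <->
  forall u, 2 * a * dot (c u - c s) (N s) <= sq (c u - c s).
Proof.
have E u : sq (c u - normal_point c d s a) - sq (c s - normal_point c d s a) =
    sq (c u - c s) - 2 * a * dot (c u - c s) (N s).
  by rewrite /sq /dot /normal_point /N /perp /=; ring.
by split=> h u; have := h u; have := E u; lra.
Qed.

(** The disc contains a left-hand normal point near [c s], whose winding number is the nonzero
    constant [W]. *)
Lemma normal_medial s a : 0 < a -> nearest c (normal_point c d s a) s ->
  medial c d L (normal_point c d s a).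
Proof.
move=> a0 no; have v0 := speed_gt0 s; set o := normal_point c d s a in no *.
have oE b : sq (normal_point c d s b - o) = (a - b) ^+ 2 * sq (d s).
  by rewrite /o /sq /dot /normal_point /=; ring.
have csE : sq (c s - o) = a ^+ 2 * sq (d s).
  by rewrite /o /sq /dot /normal_point /=; ring.
have Go : ~ range c o.
  apply: (nearest_ball no); rewrite csE [X in X < _](_ : _ = 0) ?mulr_gt0 ?exprn_gt0//.
  by rewrite /sq /dot /= !subrr mul0r addr0.
split=> //; have [r [W [r0 /eqP W0 posr]]] := pos.
pose b := Num.min (r / 2) a.
have [b0 br ba] : [/\ 0 < b, b < r & b <= a].
  have b1 : b <= r / 2 by rewrite ge_min lexx.
  by split; [rewrite lt_min divr_gt0|lra|rewrite ge_min lexx orbT].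
have [Gb wb _] := posr s b b0 br.
have := nearest_winding no Go Gb; rewrite /w wb => <- //.
rewrite oE csE ler_pM2r// ler_sqr ?nnegrE; lra.
Qed.

(** The inequality would confine the curve to the half-plane on the right of its tangent, or to a
    disc in it touching the tangent at [c s]. The left normal ray would then escape to infinity,
    although it starts at a point with nonzero winding number. *)
Lemma no_inner_halfplane s k : k <= 0 ->
  ~ (forall u, 2 * dot (c u - c s) (N s) <= k * sq (c u - c s)).
Proof.
move=> k0 h; have v0 := speed_gt0 s.
have [r [W [r0 /eqP W0 posr]]] := pos.
have [r2 rr] : 0 < r / 2 /\ r / 2 < r by split; lra.
have [_ wr _] := posr s (r / 2) r2 rr; apply: W0; rewrite -wr.
apply: (winding_outside cc); apply: (@outside_ray _ _ _ (N s)).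
  apply/eqP => -[] /eqP; rewrite oppr_eq0 => /eqP d2 d1; apply: (closed_regular cc (t := s)).
  by rewrite [LHS]surjective_pairing d1 d2.
move=> t t0 [u _ E]; have := h u.
have -> : dot (c u - c s) (N s) = (r / 2 + t) * sq (d s).
  by rewrite E /N /dot /sq /dot /perp /normal_point /=; ring.
have -> : sq (c u - c s) = (r / 2 + t) ^+ 2 * sq (d s).
  by rewrite E /N /sq /dot /perp /normal_point /=; ring.
apply/negP; rewrite -ltNge.
apply: (@le_lt_trans _ _ 0); last by rewrite !mulr_gt0//; lra.
by apply: mulr_le0_ge0 => //; rewrite mulr_ge0 ?sqr_ge0 ?(ltW v0).
Qed.

(* The curvature, scaled by the speed, of the circline touching c at s and
   passing through c u; at u = s this is the curvature of c. *)
Let tangent_curvature s u : R := if u == s then dot (e s) (N s) / sq (d s)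
  else 2 * dot (c u - c s) (N s) / sq (c u - c s).

(** Numerator and denominator of [tangent_curvature] both vanish to second order at [s]. With the
    intermediate points as functions of [u] that tend to [s], the factor [(u - s) ^+ 2] cancels,
    which yields continuity at [s]. *)
Let tangent_curvature_taylor s : exists t1 t2 : R -> R, forall u,
  [/\ `|t1 u - s| <= `|u - s|, `|t2 u - s| <= `|u - s|,
    2 * dot (c u - c s) (N s) = (u - s) ^+ 2 * dot (e (t1 u)) (N s) &
    sq (c u - c s) = (u - s) ^+ 2 *
      (sq (d (t2 u)) + dot (e (t2 u)) (c (t2 u) - c s))].
Proof.
have /choice[t1 h1] u : exists t, `|t - s| <= `|u - s| /\
    2 * dot (c u - c s) (N s) = (u - s) ^+ 2 * dot (e t) (N s).
  have [t|t|t ts] := @taylor2 R (fun u => dot (c u - c s) (N s)) (fun u => dot (d u) (N s))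
    (fun u => dot (e u) (N s)) s u.
  - by apply: is_derive_dotr; apply: pderiveB; exact: closed_deriv cc t.
  - by apply: is_derive_dotr; exact: closed_deriv2 cc t.
  move=> ->; exists t; split=> //; rewrite /N dot_perp_self subrr.
  have -> : dot 0 (perp (d s)) = 0 by rewrite /dot /= !mul0r addr0.
  by field.
have /choice[t2 h2] u : exists t, `|t - s| <= `|u - s| /\
    sq (c u - c s) = (u - s) ^+ 2 * (sq (d t) + dot (e t) (c t - c s)).
  have [t|t|t ts] := @taylor2 R (fun u => sq (c u - c s)) (fun u => 2 * dot (d u) (c u - c s))
    (fun u => 2 * (sq (d u) + dot (e u) (c u - c s))) s u.
  - exact: is_derive_sqB.
  - have h := is_derive_dot (closed_deriv2 cc t) (pderiveB (c s) (closed_deriv cc t)).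
    by apply: is_derive_eq; rewrite /GRing.scale /= /sq; ring.
  move=> ->; exists t; split=> //; rewrite subrr.
  have -> : dot (d s) 0 = 0 by rewrite /dot /= !mulr0 addr0.
  have -> : sq 0 = 0 :> R by rewrite /sq /dot /= !mulr0 addr0.
  by field.
exists t1, t2 => u; have [? ?] := h1 u; have [? ?] := h2 u; split=> //.
Qed.

Let tangent_curvature_continuous s u : `|u - s| <= L / 2 ->
  {for u, continuous (tangent_curvature s)}.
Proof.
have [cx cy] : continuous (fun t => (c t).1) /\ continuous (fun t => (c t).2).
  by split=> t; have [] := pderive_continuous (closed_deriv cc t).
have [dx dy] : continuous (fun t => (d t).1) /\ continuous (fun t => (d t).2).
  by split=> t; have [] := pderive_continuous (closed_deriv2 cc t).
have [ex ey] := (closed_cont1 cc, closed_cont2 cc).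
have cB (k : R -> R) (r t : R) : continuous k -> {for t, continuous (fun t => k t - r)}.
  by move=> ck; apply: (fun_continuousB (ck t)); exact: cvg_cst.
move=> us; have [->|usn] := eqVneq u s.
  have [t1 [t2 ht]] := tangent_curvature_taylor s.
  have tc (t : R -> R) : (forall u, `|t u - s| <= `|u - s|) -> {for s, continuous t} /\ t s = s.
    move=> ts; have tss : t s = s.
      by apply/eqP; rewrite -subr_eq0 -normr_le0 (le_trans (ts s))// subrr normr0.
    split=> //; apply/cvgrPdist_lt => eps eps0; rewrite tss.
    apply: filterS (nbhsx_ballx s eps eps0) => x; rewrite -ball_normE /= => xs.
    by rewrite distrC (le_lt_trans (ts x))// distrC.
  have [t1c t1s] := tc t1 (fun u => let: And4 h _ _ _ := ht u in h).
  have [t2c t2s] := tc t2 (fun u => let: And4 _ h _ _ := ht u in h).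
  pose nu t := dot (e t) (N s).
  pose de t := sq (d t) + dot (e t) (c t - c s).
  have nuc : {for s, continuous nu} by exact: continuous_dotr (ex s) (ey s).
  have dec : {for s, continuous de}.
    apply: fun_continuousD.
      exact: (fun_continuousD (fun_continuousM (dx s) (dx s)) (fun_continuousM (dy s) (dy s))).
    exact: (fun_continuousD (fun_continuousM (ex s) (cB _ (c s).1 s cx))
      (fun_continuousM (ey s) (cB _ (c s).2 s cy))).
  have des : de s = sq (d s).
    by rewrite /de /dot /= !subrr !mulr0 !addr0.
  have -> : tangent_curvature s = fun u => nu (t1 u) / de (t2 u).
    apply/funext => x; rewrite /tangent_curvature.
    have [->|xs] := eqVneq x s; first by rewrite t1s t2s des.
    have [_ _ -> ->] := ht x; rewrite -/(nu _) -/(de _) invfM.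
    have x0 : (x - s) ^+ 2 != 0 by rewrite expf_neq0// subr_eq0.
    by rewrite mulrACA mulfV// mul1r.
  apply: fun_continuousM.
    by apply: (@continuous_comp _ _ _ t1 nu) => //; rewrite t1s.
  apply: fun_continuousV; last by rewrite t2s des gt_eqF// speed_gt0.
  by apply: (@continuous_comp _ _ _ t2 de) => //; rewrite t2s.
have csu : sq (c u - c s) != 0.
  rewrite gt_eqF// sqB_gt0//.
  have [ltus|ltsu|E] := ltgtP u s; last by rewrite E eqxx in usn.
    by apply: (closed_simple cc) => //; move: us; rewrite ler_norml => /andP[]; lra.
  by apply/nesym; apply: (closed_simple cc) => //; move: us; rewrite ler_norml => /andP[]; lra.
have qc : {for u, continuous (fun u => 2 * dot (c u - c s) (N s) / sq (c u - c s))}.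
  apply: fun_continuousM.
    apply: fun_continuousM; first exact: cvg_cst.
    exact: (@continuous_dotr _ (fun u => c u - c s)) (cB _ _ _ cx) (cB _ _ _ cy).
  apply: fun_continuousV => //; exact: sq_continuous (cx u) (cy u).
have E : \forall x \near u, 2 * dot (c x - c s) (N s) / sq (c x - c s) = tangent_curvature s x.
  have us0 : 0 < `|u - s| by rewrite normr_gt0 subr_eq0.
  apply: filterS (nbhsx_ballx u _ us0) => x; rewrite -ball_normE /= => ux.
  rewrite /tangent_curvature ifF//; apply/eqP => xs; by rewrite xs ltxx in ux.
rewrite /prop_for /continuous_at /tangent_curvature (negPf usn).
by apply: cvg_trans qc; apply: near_eq_cvg.
Qed.

(** The largest disc belongs to the maximum [k] of [tangent_curvature s] over a period centred at
    [s], and [k] is positive by [no_inner_halfplane]. If the maximum is attained at [s], the disc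
    osculates; otherwise the place where it is attained is a second contact. *)
Lemma medial_exists s : (forall u, 0 <= osculating_form c d e s (c u)) \/
  exists t, [/\ s < t, t < s + L & bitangent c d L s t].
Proof.
have v0 := speed_gt0 s; have l0 := L0.
have sL : s - L / 2 <= s + L / 2 by lra.
have itvE t : t \in `[s - L / 2, s + L / 2]%R -> `|t - s| <= L / 2.
  by rewrite in_itv /= ler_norml => /andP[? ?]; apply/andP; split; lra.
have [|m mI mM] := @EVT_max R (tangent_curvature s) _ _ sL.
  apply: continuous_in_subspaceT => t; rewrite inE => tI.
  by apply: tangent_curvature_continuous; exact: itvE.
set k := tangent_curvature s m in mM.
have kle u : 2 * dot (c u - c s) (N s) <= k * sq (c u - c s).
  have [t [t1 t2 <- _ _]] := closed_window cc (s - L / 2) u.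
  have /mM : t \in `[s - L / 2, s + L / 2]%R by rewrite in_itv /=; apply/andP; split; lra.
  rewrite /tangent_curvature; case: eqP => [->|ts].
    by move=> _; rewrite /sq /dot /= !subrr !mul0r !addr0 !mulr0.
  rewrite ler_pdivrMr//; apply: sqB_gt0.
  have [lts|sltt|] := ltgtP t s => //; last by apply/nesym; apply: (closed_simple cc); lra.
  by apply: (closed_simple cc); lra.
have k0 : 0 < k.
  by rewrite ltNge; apply/negP => k0; exact: no_inner_halfplane k0 kle.
pose o := normal_point c d s k^-1.
have no : nearest c o s.
  apply/nearest_normalP => u; rewrite mulrAC ler_pdivrMr//.
  by rewrite [X in _ <= X]mulrC; exact: kle.
have [ms|ms] := eqVneq m s.
  left => u; have kE : dot (e s) (N s) = k * sq (d s).
    by rewrite /k /tangent_curvature ms eqxx divfK// gt_eqF.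
  rewrite /osculating_form -/(N s) kE.
  have : 0 <= sq (d s) * (k * sq (c u - c s) - 2 * dot (c u - c s) (N s)).
    by rewrite mulr_ge0 ?(ltW v0)// subr_ge0.
  lra.
right; have cm : c m <> c s.
  move: (itvE _ mI); rewrite ler_norml => /andP[? ?].
  have [lts|sltt|E] := ltgtP m s; last by rewrite E eqxx in ms.
    by apply: (closed_simple cc); lra.
  by apply/nesym; apply: (closed_simple cc); lra.
have mE : 2 * dot (c m - c s) (N s) = k * sq (c m - c s).
  by rewrite /k /tangent_curvature (negPf ms) divfK// gt_eqF// sqB_gt0.
have nm : nearest c o m.
  move=> u; apply: le_trans (no u).
  have -> : sq (c m - o) = sq (c s - o) + (sq (c m - c s) - k^-1 * (2 * dot (c m - c s) (N s))).
    by rewrite /o /sq /dot /normal_point /N /perp /=; ring.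
  by rewrite mE mulKf ?gt_eqF// subrr addr0.
have mo : medial c d L o by apply: normal_medial => //; rewrite invr_gt0.
move: (itvE _ mI); rewrite ler_norml => /andP[m1 m2].
have [lts|sltt|E] := ltgtP m s; last by rewrite E eqxx in ms.
- exists (m + L); split; [lra|lra|exists o; split=> //].
  by move=> u; rewrite (closed_period cc).
- by exists m; split; [lra|lra|exists o].
Qed.

End OneCurve.
End Inscribed.

(** * Inscribed discs do not cross *)

Section Crossing.
Variable R : realType.
Implicit Types (q o v x : R * R) (c d e : R -> R * R) (s t u : R).

Definition chord q q' t : R * R := (q.1 + t * (q' - q).1, q.2 + t * (q' - q).2).

Lemma chord0 q q' : chord q q' 0 = q.
Proof. by rewrite /chord !mul0r !addr0 -surjective_pairing. Qed.

Lemma chord1 q q' : chord q q' 1 = q'.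
Proof. by rewrite /chord !mul1r /= addrC subrK addrC subrK -surjective_pairing. Qed.

Lemma sq_chord q q' o t : sq (chord q q' t - o) =
  (1 - t) * sq (q - o) + t * sq (q' - o) - t * (1 - t) * sq (q' - q).
Proof. by rewrite /sq /dot /chord /=; ring. Qed.

Lemma chord_C1path q q' : C1path (chord q q') (fun=> q' - q).
Proof.
split; [|exact: cst_continuous|exact: cst_continuous].
by move=> t; split; apply: is_derive_eq; rewrite /GRing.scale /=; ring.
Qed.

Section Chain.
Variables (c d c' d' : R -> R * R) (a b k : R).
Hypotheses (cd : C1path c d) (cd' : C1path c' d') (ab : a <= b).
(** The boundary of the chain vanishes as a formal sum of points. It is paired with functions
    because it gets applied to [arg_between] and [arg_from]. *)
Hypothesis closes : forall f : R * R -> R,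
  f (c b) - f (c a) + k * (f (c' 1) - f (c' 0)) = 0.

(* Winding number of the loop made of c on [a, b] and of c' on [0, 1], the
   latter run backwards if k = -1. *)
Definition chain_winding x : R := angle c d x a b + k * angle c' d' x 0 1.

Lemma chain_winding_local x : (forall t, a <= t <= b -> c t <> x) ->
  (forall t, 0 <= t <= 1 -> c' t <> x) ->
  exists2 r : R, 0 < r & forall x', `|x'.1 - x.1| < r -> `|x'.2 - x.2| < r ->
    chain_winding x' = chain_winding x.
Proof.
move=> cx c'x.
have [m m0 hm] := path_distance cd ab cx.
have [m' m'0 hm'] := path_distance cd' ler01 c'x.
have [r r0 hr] := dot_near m0 hm; have [r' r'0 hr'] := dot_near m'0 hm'.
exists (Num.min r r'); first by rewrite lt_min r0.
move=> x'; rewrite !lt_min => /andP[h1 h1'] /andP[h2 h2'].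
have E := angle_sub cd ab (hr x' h1 h2).
have E' := angle_sub cd' ler01 (hr' x' h1' h2').
apply/eqP; rewrite -subr_eq0 -(closes (arg_between x x')) -E -E'.
by apply/eqP; rewrite /chain_winding; ring.
Qed.

Lemma chain_winding_connected (X : set (R * R)) : connected X ->
  (forall x, X x -> (forall t, a <= t <= b -> c t <> x) /\
     (forall t, 0 <= t <= 1 -> c' t <> x)) ->
  forall x x', X x -> X x' -> chain_winding x = chain_winding x'.
Proof.
move=> cX XG; apply: (locally_constant_connected cX) => x Xx.
have [h1 h2] := XG x Xx.
have [r r0 hr] := chain_winding_local h1 h2.
by exists r => // x' _; exact: hr.
Qed.

Lemma chain_winding_halfplane x v : (forall t, a <= t <= b -> 0 < dot v (c t - x)) ->
  (forall t, 0 <= t <= 1 -> 0 < dot v (c' t - x)) -> chain_winding x = 0.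
Proof.
move=> h1 h2; rewrite /chain_winding (angle_halfplane cd ab h1).
by rewrite (angle_halfplane cd' ler01 h2) closes.
Qed.

End Chain.

Section OneCurve.
Variables (c d e : R -> R * R) (L : R).
Hypotheses (cc : closed_curve c d e L) (pos : positively_oriented c d L).
Let w := winding c d L.

Lemma nearest_chord o s t k : nearest c o s -> nearest c o t -> ~ range c o ->
  c s <> c t -> 0 < k -> k < 1 ->
  ~ range c (chord (c s) (c t) k) /\ w (chord (c s) (c t) k) = w o.
Proof.
move=> ns nt Go st k0 k1.
have lt : sq (chord (c s) (c t) k - o) < sq (c s - o).
  have E : sq (c t - o) = sq (c s - o) by apply/eqP; rewrite eq_le ns nt.
  have : 0 < k * (1 - k) * sq (c t - c s).
    by rewrite !mulr_gt0 ?subr_gt0 ?sqB_gt0//; exact: nesym.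
  rewrite sq_chord E; lra.
have G := nearest_ball ns lt; split=> //.
exact: (nearest_winding cc ns Go G (ltW lt)).
Qed.

(** Supplies the points at which locally constant winding numbers near the curve are evaluated in
    [nearest_noncrossing]. *)
Lemma right_probe s (r : R) : 0 < r -> exists x,
  [/\ outside (range c) x, `|x.1 - (c s).1| < r & `|x.2 - (c s).2| < r].
Proof.
move=> r0; have [r1 [W [r10 _ posr]]] := pos.
have [B B0 hB] := closed_bounded cc; have [_ _ d1 d2 _] := hB s.
pose a := Num.min (r1 / 2) (r / (2 * B)).
have aB : a * B <= r / 2.
  have : a <= r / (2 * B) by rewrite ge_min lexx orbT.
  by rewrite ler_pdivlMr ?mulr_gt0//; lra.
have a0 : 0 < a by rewrite lt_min !divr_gt0// mulr_gt0.
have ar : a < r1 by have : a <= r1 / 2 by [rewrite ge_min lexx]; lra.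
have [_ _ out] := posr s a a0 ar.
have small (y : R) : `|y| <= B -> `|a * y| < r.
  move=> yB; rewrite normrM gtr0_norm//.
  by have : a * `|y| <= a * B by [rewrite ler_pM2l]; lra.
exists (normal_point c d s (- a)); split=> //=.
  by rewrite (_ : _ - _ = a * (d s).2); [exact: small|ring].
by rewrite (_ : _ - _ = a * - (d s).1); [rewrite small// normrN|ring].
Qed.

(* The chords [c p, c p'] and [c q, c q'] lie in the discs about o and o'. They
   cross, because the loop made of the arc from p to p' and of the first chord
   winds around the points of the second one near c q, but not around those near
   c q'. The difference of the powers with respect to both circles is an affine
   function, nonpositive at c p and c p', nonnegative at c q and c q', so that
   at the crossing it vanishes, and hence it also vanishes at c q. *)
Lemma nearest_noncrossing o o' (p p' q q' : R) : p < q -> q < p' -> p' < q' -> q' < p + L ->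
  medial c d L o -> nearest c o p -> nearest c o p' ->
  medial c d L o' -> nearest c o' q -> nearest c o' q' -> nearest c o q.
Proof.
move=> pq qp' p'q' q'p [Go wo] np np' [Go' wo'] nq nq'.
have cpp' : c p' <> c p by apply/nesym; apply: (closed_simple cc); lra.
have cqq' : c q <> c q' by apply: (closed_simple cc); lra.
have C1 := closed_C1path cc.
set sg := chord (c p') (c p); pose sd := fun _ : R => c p - c p'.
have C1' : C1path sg sd := chord_C1path (c p') (c p).
have sg0 : sg 0 = c p' := chord0 _ _; have sg1 : sg 1 = c p := chord1 _ _.
have pp' : p <= p' by lra.
have p'p : p' <= p + L by lra.
(* The first chord cuts the curve into two loops that run through it in opposite directions, whence
   [A + B = w]. *)
pose A := chain_winding c d sg sd p p' 1.
pose B := chain_winding c d sg sd p' (p + L) (-1).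
have clA (f : R * R -> R) : f (c p') - f (c p) + 1 * (f (sg 1) - f (sg 0)) = 0.
  by rewrite sg0 sg1; ring.
have clB (f : R * R -> R) : f (c (p + L)) - f (c p') + (-1) * (f (sg 1) - f (sg 0)) = 0.
  by rewrite sg0 sg1 (closed_period cc); ring.
have AB x : ~ range c x -> A x + B x = w x.
  move=> Gx; rewrite /w -(winding_shift cc p Gx).
  rewrite (angle_cat C1 pp' p'p) => [|t _]; last exact: off_curve.
  by rewrite /A /B /chain_winding; ring.
have sgw k : 0 < k -> k < 1 -> ~ range c (sg k) /\ w (sg k) = w o.
  exact: nearest_chord.
have sgG s : c s <> c p -> c s <> c p' -> forall t, 0 <= t <= 1 -> sg t <> c s.
  move=> sp sp' t; rewrite !le_eqVlt => /andP[/predU1P[<-|t0] /predU1P[t1|t1]];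
    try by rewrite ?sg0 ?t1 ?sg1; apply/nesym.
  by move=> E; have [+ _] := sgw t t0 t1; apply; exists s.
have cpp : c (p + L) = c p := closed_period cc p.
(* The component of an outside point misses the open chord, along which [w] is nonzero. Hence [A] is
   constant on it and can be evaluated at a far point. *)
have A0 x : outside (range c) x -> A x = 0.
  move=> xout; have [Gx bx] := xout.
  set X := connected_component (~` range c) x in bx.
  have cX : connected X by exact: component_connected.
  have XG : X `<=` ~` range c by exact: connected_component_sub.
  have Xx : X x by exact: connected_component_refl.
  have [b b0 hb] := closed_bounded cc.
  have [y Xy yb] : exists2 y, X y & ~ (`|y.1| <= b /\ `|y.2| <= b).
    apply: contrapT => h; apply: bx; apply/boundedP; exists b => y Xy.
    by apply: contrapT => yb; apply: h; exists y.
  have Xw y' : X y' -> w y' = 0.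
    by move=> Xy'; rewrite /w -(winding_connected cc cX XG Xx Xy') (winding_outside cc xout).
  have -> : A x = A y.
    apply: (chain_winding_connected C1 C1' pp' clA cX) => // z Xz; split.
      by move=> t _; apply: off_curve; exact: XG.
    move=> t; rewrite !le_eqVlt => /andP[/predU1P[<-|t0] /predU1P[t1|t1]].
    - by move: t1 => /eqP; rewrite eq_sym oner_eq0.
    - by rewrite sg0; apply: off_curve; exact: XG.
    - by rewrite t1 sg1; apply: off_curve; exact: XG.
    - move=> E; apply: wo; rewrite -/w -(sgw t t0 t1).2 E; exact: Xw.
  have [v hv] := far_halfplane b0 yb.
  apply: (chain_winding_halfplane (v := v) C1 C1' pp' clA) => t.
    by move=> _; have [c1 c2 _ _ _] := hb t; exact: hv.
  move=> /andP[t0 t1]; have [c1 c2 _ _ _] := hb p; have [c1' c2' _ _ _] := hb p'.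
  have -> : dot v (sg t - y) = t * dot v (c p - y) + (1 - t) * dot v (c p' - y).
    by rewrite /sg /chord /dot /=; ring.
  have h1 := hv _ c1 c2; have h2 := hv _ c1' c2'.
  have [->|tn0] := eqVneq t 0; first by rewrite mul0r add0r subr0 mul1r.
  rewrite ltr_pwDl ?mulr_gt0//; first by rewrite lt_def tn0.
  by rewrite mulr_ge0 ?subr_ge0// ltW.
(* [c q] is not on the loop of [B], so [B] is constant nearby; at an outside point it equals
   [w - A = 0]. *)
have [r r0 hr] : exists2 r : R, 0 < r & forall x, `|x.1 - (c q).1| < r ->
    `|x.2 - (c q).2| < r -> ~ range c x -> A x = w x.
  have [||r r0 hr] := @chain_winding_local c d sg sd p' (p + L) (-1) C1 C1' p'p clB (c q).
  - by move=> t /andP[? ?]; apply/nesym; apply: (closed_simple cc); lra.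
  - by apply: sgG; [apply/nesym|]; apply: (closed_simple cc); lra.
  exists r => // x x1 x2 Gx; have [y [yout y1 y2]] := right_probe q r0.
  have By : B y = 0.
    have := AB y (proj1 yout); rewrite (A0 y yout) add0r => ->.
    exact: (winding_outside cc yout).
  rewrite -(AB x Gx) (_ : B x = 0) ?addr0//.
  by rewrite -By /B (hr x x1 x2) (hr y y1 y2).
(* Likewise [c q'] is not on the loop of [A], and an outside point nearby shows that [A] is 0 around
   it. *)
have [r' r'0 hr'] : exists2 r : R, 0 < r & forall x, `|x.1 - (c q').1| < r ->
    `|x.2 - (c q').2| < r -> A x = 0.
  have [||r' r'0 hr'] := @chain_winding_local c d sg sd p p' 1 C1 C1' pp' clA (c q').
  - by move=> t /andP[? ?]; apply: (closed_simple cc); lra.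
  - apply: sgG; last by apply/nesym; apply: (closed_simple cc); lra.
    by apply/nesym; apply: (closed_simple cc); lra.
  exists r' => // x x1 x2; have [y [yout y1 y2]] := right_probe q' r'0.
  by rewrite -(A0 y yout) /A (hr' x x1 x2) (hr' y y1 y2).
set tau := chord (c q) (c q').
have tauw k : 0 < k -> k < 1 -> ~ range c (tau k) /\ w (tau k) = w o'.
  exact: nearest_chord.
have [k [k' [k0 k1 k'0 k'1 E]]] : exists k k', [/\ 0 < k, k < 1, 0 <= k', k' <= 1 & tau k = sg k'].
  (* Without a crossing, [A] would be constant along the open second chord, with value [w o'] near
     [c q] and 0 near [c q']; [k] is small enough for [tau k] and [tau (1 - k)] to be in these two
     neighbourhoods. *)
  apply: contrapT => nocross.
  set v := c q' - c q; pose M := 1 + `|v.1| + `|v.2|.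
  have M0 : 0 < M by rewrite /M ltr_wpDr// ltr_wpDr.
  pose k := Num.min (1 / 2) (Num.min r r' / (2 * M)).
  have k0 : 0 < k by rewrite lt_min !divr_gt0 ?mulr_gt0 ?lt_min ?r0.
  have k1 : k < 1 by have : k <= 1 / 2 by [rewrite ge_min lexx]; lra.
  have kM : k * M <= Num.min r r' / 2.
    have : k <= Num.min r r' / (2 * M) by rewrite ge_min lexx orbT.
    by rewrite ler_pdivlMr ?mulr_gt0//; lra.
  have small (y : R) : `|y| <= M -> `|k * y| < r /\ `|k * y| < r'.
    move=> yM; apply/andP; rewrite -lt_min normrM (gtr0_norm k0).
    have : k * `|y| <= k * M by rewrite ler_pM2l.
    have : 0 < Num.min r r' by rewrite lt_min r0.
    lra.
  have [s1 s1'] : `|k * v.1| < r /\ `|k * v.1| < r'.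
    by apply: small; rewrite /M; have := normr_ge0 v.2; lra.
  have [s2 s2'] : `|k * v.2| < r /\ `|k * v.2| < r'.
    by apply: small; rewrite /M; have := normr_ge0 v.1; lra.
  have [Gk wk] := tauw k k0 k1.
  have Ak : A (tau k) = w o'.
    rewrite -wk; apply: hr => //.
      by rewrite (_ : _ - _ = k * v.1)//; rewrite /tau /chord /v /=; ring.
    by rewrite (_ : _ - _ = k * v.2)//; rewrite /tau /chord /v /=; ring.
  have Ak' : A (tau (1 - k)) = 0.
    apply: hr'.
      by rewrite (_ : _ - _ = - (k * v.1)) ?normrN//; rewrite /tau /chord /v /=; ring.
    by rewrite (_ : _ - _ = - (k * v.2)) ?normrN//; rewrite /tau /chord /v /=; ring.
  apply: wo'; rewrite -/w -Ak -Ak'.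
  apply: (@chain_winding_connected c d sg sd p p' 1 C1 C1' pp' clA (tau @` `]0, 1[%classic)).
  - apply: path_connected; last exact: affine_continuous.
    exact/connected_intervalP/interval_is_interval.
  - move=> _ [t /= + <-]; rewrite in_itv /= => /andP[t0 t1]; split.
      by move=> u _; apply: off_curve; have [] := tauw t t0 t1.
    move=> u /andP[u0 u1] E; apply: nocross.
    by exists t, u; split.
  - by exists k => //=; rewrite in_itv /= k0.
  - by exists (1 - k) => //=; rewrite in_itv /= subr_gt0 k1 gtrBl.
have {}k'0 : 0 < k'.
  rewrite lt_def k'0 andbT; apply/eqP => k'E; have [+ _] := tauw k k0 k1.
  by apply; exists p' => //; rewrite E k'E sg0.
have {}k'1 : k' < 1.
  rewrite lt_neqAle k'1 andbT; apply/eqP => k'E; have [+ _] := tauw k k0 k1.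
  by apply; exists p => //; rewrite E k'E sg1.
pose l x := (sq (x - o) - sq (c p - o)) - (sq (x - o') - sq (c q - o')).
have Ep : sq (c p' - o) = sq (c p - o) by apply/eqP; rewrite eq_le np np'.
have Eq : sq (c q' - o') = sq (c q - o') by apply/eqP; rewrite eq_le nq nq'.
have lchord x x' t : l (chord x x' t) = (1 - t) * l x + t * l x'.
  by rewrite /l !sq_chord; ring.
have lE : (1 - k) * l (c q) + k * l (c q') = (1 - k') * l (c p') + k' * l (c p).
  by rewrite -!lchord -/(tau k) E.
have lp : l (c p) <= 0 by rewrite /l subrr sub0r oppr_le0 subr_ge0.
have lp' : l (c p') <= 0 by rewrite /l Ep subrr sub0r oppr_le0 subr_ge0.
have lq : 0 <= l (c q) by rewrite /l subrr subr0 subr_ge0.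
have lq' : 0 <= l (c q') by rewrite /l Eq subrr subr0 subr_ge0.
have lq0 : l (c q) = 0.
  apply/eqP; rewrite eq_le lq andbT -(pmulr_rle0 _ (_ : 0 < 1 - k)) ?subr_gt0//.
  have : (1 - k') * l (c p') <= 0 by rewrite pmulr_rle0// subr_gt0.
  have : k' * l (c p) <= 0 by rewrite pmulr_rle0.
  have : 0 <= k * l (c q') by rewrite pmulr_rge0.
  lra.
move=> u; apply: le_trans (np u).
by move: lq0; rewrite /l subrr subr0 => /eqP; rewrite subr_eq0 => /eqP ->.
Qed.

End OneCurve.
End Crossing.

(** * Osculating discs by bisection *)

Section InnerPoints.
Variable R : realType.
Implicit Types (q o v x : R * R) (c d e : R -> R * R) (s t u r : R).

Lemma continuous_gt0_box (f : R * R -> R) x : {for x, continuous f} -> 0 < f x ->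
  exists2 r, 0 < r & forall y, `|y.1 - x.1| < r -> `|y.2 - x.2| < r -> 0 < f y.
Proof.
move=> cf fx; apply/plane_nbhs_box.
exact: (cf [set z | 0 < z] (lt_nbhsr fx)).
Qed.

Section OneCurve.
Variables (c d e : R -> R * R) (L : R).
Hypotheses (cc : closed_curve c d e L) (pos : positively_oriented c d L).

(** For positive curvature [osculating_form] is negative exactly on the open osculating disc, so
    that the curve avoids this disc. Positivity itself follows from the orientation, see
    [supports_inner_center]. *)
Definition supports_inner s := forall u, 0 <= osculating_form c d e s (c u).

(* By Rolle's theorem the second derivative of the squared distance to the
   common centre vanishes between s and t, so that the limiting circle
   osculates c. *)
Lemma bitangent_limit (x : R) : ~ supports_inner x ->
  exists2 r, 0 < r & forall s t, `|s - x| < r -> s < t -> t < s + r ->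
    ~ bitangent c d L s t.
Proof.
move=> /existsNP[u0 /negP]; rewrite -ltNge => osc.
have [cx cy] : continuous (fun t => (c t).1) /\ continuous (fun t => (c t).2).
  by split=> t; have [] := pderive_continuous (closed_deriv cc t).
have [dx dy] : continuous (fun t => (d t).1) /\ continuous (fun t => (d t).2).
  by split=> t; have [] := pderive_continuous (closed_deriv2 cc t).
have [ex ey] := (closed_cont1 cc, closed_cont2 cc).
(* For a centre at normal parameter [a], Rolle's equation reads
   [psi (s, v) = a * dot (e v) (perp (d s))]. Eliminating [a] from the condition that [c u0] is not
   in the open disc gives [phi (s, v) <= 0], whereas [phi (x, x) = - osculating_form c d e x (c u0)]
   is positive. *)
pose psi (z : R * R) := sq (d z.2) + dot (e z.2) (c z.2 - c z.1).
pose phi (z : R * R) := 2 * psi z * dot (c u0 - c z.1) (perp (d z.1)) -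
  sq (c u0 - c z.1) * dot (e z.2) (perp (d z.1)).
have c1 (f : R -> R) : continuous f -> {for (x, x), continuous (fun z : R * R => f z.1)}.
  by move=> cf; apply: (@continuous_comp _ _ _ (fun z : R * R => z.1) f); [exact: cvg_fst|exact: cf].
have c2 (f : R -> R) : continuous f -> {for (x, x), continuous (fun z : R * R => f z.2)}.
  by move=> cf; apply: (@continuous_comp _ _ _ (fun z : R * R => z.2) f); [exact: cvg_snd|exact: cf].
have cdot (a b a' b' : R * R -> R) :
    {for (x, x), continuous a} -> {for (x, x), continuous b} ->
    {for (x, x), continuous a'} -> {for (x, x), continuous b'} ->
    {for (x, x), continuous (fun z => dot (a z, b z) (a' z, b' z))}.
  by move=> ? ? ? ?; apply: fun_continuousD; exact: fun_continuousM.
have ccst (k : R) : {for (x, x), continuous (fun _ : R * R => k)} by exact: cvg_cst.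
have psic : {for (x, x), continuous psi}.
  apply: fun_continuousD.
    exact: (cdot _ _ _ _ (c2 _ dx) (c2 _ dy) (c2 _ dx) (c2 _ dy)).
  exact: (cdot _ _ _ _ (c2 _ ex) (c2 _ ey) (fun_continuousB (c2 _ cx) (c1 _ cx))
    (fun_continuousB (c2 _ cy) (c1 _ cy))).
have nx : {for (x, x), continuous (fun z : R * R => - (d z.1).2)}.
  exact: continuousN (c1 _ dy).
have ux := fun_continuousB (ccst (c u0).1) (c1 _ cx).
have uy := fun_continuousB (ccst (c u0).2) (c1 _ cy).
have phic : {for (x, x), continuous phi}.
  apply: fun_continuousB; apply: fun_continuousM.
  - by apply: fun_continuousM => //; exact: ccst.
  - exact: (cdot _ _ _ _ ux uy nx (c1 _ dx)).
  - exact: (cdot _ _ _ _ ux uy ux uy).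
  - exact: (cdot _ _ _ _ (c2 _ ex) (c2 _ ey) nx (c1 _ dx)).
have psixx : psi (x, x) = sq (d x).
  by rewrite /psi /= /dot /= !subrr !mulr0 !addr0.
have [r1 r10 h1] := continuous_gt0_box psic (eq_ind_r (fun y => 0 < y) (speed_gt0 cc x) psixx).
have phixx : 0 < phi (x, x).
  by move: osc; rewrite /phi psixx /osculating_form /=; lra.
have [r2 r20 h2] := continuous_gt0_box phic phixx.
pose r := Num.min r1 r2 / 2.
have r12 : 0 < Num.min r1 r2 by rewrite lt_min r10.
exists r; first by rewrite divr_gt0.
move=> s t sx st tr [ o [mo ns nt]].
have [a a0 oE] := medial_center cc pos mo ns.
have [v /andP[sv vt] E] := mean_value st (fun u _ =>
  is_derive_eq (is_derive_dot (closed_deriv2 cc u) (pderiveB o (closed_deriv cc u))) erefl).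
rewrite (nearest_critical cc ns) (nearest_critical cc nt) subrr in E.
have {}E : psi (s, v) = a * dot (e v) (perp (d s)).
  have /eqP : (dot (e v) (c v - o) + dot (d v) (d v)) * (t - s) = 0 by rewrite -E.
  rewrite mulf_eq0 [t - s == 0]subr_eq0 (gt_eqF st) orbF => /eqP; rewrite oE => E'.
  rewrite -[RHS]addr0 -E' /psi /sq /dot /normal_point /perp /=; ring.
have hbox (y : R) : `|y - x| < Num.min r1 r2 -> `|y - x| < r1 /\ `|y - x| < r2.
  by rewrite lt_min => /andP.
have [sx1 sx2] : `|s - x| < r1 /\ `|s - x| < r2 by apply: hbox; rewrite /r in sx; lra.
have [vx1 vx2] : `|v - x| < r1 /\ `|v - x| < r2.
  apply: hbox; move: sx; rewrite /r !ltr_norml => /andP[? ?]; rewrite /r in tr.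
  by apply/andP; split; lra.
have psi0 := h1 (s, v) sx1 vx1; have phi0 := h2 (s, v) sx2 vx2.
have := (nearest_normalP c d s a).1; rewrite -oE => /(_ ns u0) near.
have : a * phi (s, v) = psi (s, v) * (2 * a * dot (c u0 - c s) (perp (d s)) - sq (c u0 - c s)).
  transitivity (2 * a * psi (s, v) * dot (c u0 - c s) (perp (d s)) -
      sq (c u0 - c s) * (a * dot (e v) (perp (d s)))); first by rewrite /phi /=; ring.
  by rewrite -E; ring.
have : 0 < a * phi (s, v) by rewrite mulr_gt0.
have : psi (s, v) * (2 * a * dot (c u0 - c s) (perp (d s)) - sq (c u0 - c s)) <= 0.
  by rewrite pmulr_rle0// subr_le0.
lra.
Qed.

(** Discs touching the curve at the same point are nested. Were one larger, its interior would
    contain the second contact of the other, which is a point of the curve. *)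
Lemma shared_nearest o o' s r t : medial c d L o -> medial c d L o' ->
  nearest c o s -> nearest c o t -> nearest c o' r -> nearest c o' t ->
  c s <> c t -> c r <> c t -> nearest c o r.
Proof.
move=> mo mo' ns nt nr nt' st rt.
have [a a0 oE] := medial_center cc pos mo nt.
have [a' a'0 oE'] := medial_center cc pos mo' nt'.
have h := (nearest_normalP c d t a).1; rewrite -oE in h; have {}h := h nt.
have h' := (nearest_normalP c d t a').1; rewrite -oE' in h'; have {}h' := h' nt'.
have eqn (o1 : R * R) b y : o1 = normal_point c d t b -> nearest c o1 y -> nearest c o1 t ->
    2 * b * dot (c y - c t) (perp (d t)) = sq (c y - c t).
  move=> o1E ny nt1; have : sq (c y - o1) = sq (c t - o1) by apply/eqP; rewrite eq_le ny nt1.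
  rewrite o1E => Ey; apply/eqP; rewrite -subr_eq0 -oppr_eq0 opprB; apply/eqP.
  transitivity (sq (c y - normal_point c d t b) - sq (c t - normal_point c d t b)).
    by rewrite /sq /dot /normal_point /perp /=; ring.
  by rewrite Ey subrr.
have le b b' y : 0 < b -> 0 < b' -> c y <> c t ->
    2 * b * dot (c y - c t) (perp (d t)) = sq (c y - c t) ->
    2 * b' * dot (c y - c t) (perp (d t)) <= sq (c y - c t) -> b' <= b.
  move=> b0 b'0 yt E; have := sqB_gt0 yt; rewrite -E.
  set D := dot _ _ => S0.
  have D0 : 0 < D by rewrite -(pmulr_rgt0 _ (_ : 0 < 2 * b))// mulr_gt0.
  by rewrite ler_pM2r// ler_pM2l.
have h1 : a' <= a := le _ _ _ a0 a'0 st (eqn _ _ _ oE ns nt) (h' s).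
have h2 : a <= a' := le _ _ _ a'0 a0 rt (eqn _ _ _ oE' nr nt') (h r).
suff -> : o = o' by [].
by rewrite oE oE' (@le_anti _ _ a a') // h1 h2.
Qed.

(** The second contact [r'] of the largest disc at [r] must lie between [s] and [t] up to a period:
    beyond them the contact pairs would interlace, and at them the discs would share a contact.
    Either way the two discs would coincide and [r] would be a contact of the given one. *)
Lemma bitangent_trap o s t r : medial c d L o -> nearest c o s -> nearest c o t ->
  s < r -> r < t -> t < s + L -> ~ nearest c o r ->
  [\/ supports_inner r, exists r', [/\ r < r', r' < t & bitangent c d L r r'] |
    exists r', [/\ s < r', r' < r & bitangent c d L r' r]].
Proof.
move=> mo ns nt sr rt tL nr.
have [|[r' [rr' r'L [ o' [mo' no' no'']]]]] := medial_exists cc pos r; first by constructor 1.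
have ct : c s <> c t by apply: (closed_simple cc); lra.
have [r't|tr'|E] := ltgtP r' t.
- by constructor 2; exists r'; split=> //; exists o'.
- have [r's|sr'|E] := ltgtP r' (s + L).
  + case: nr; exact: (nearest_noncrossing cc pos sr rt tr' r's mo ns nt mo' no' no'').
  + constructor 3; exists (r' - L); split; [lra|lra|exists o'; split=> //].
    by move=> u; rewrite -(closed_period cc (r' - L)) subrK.
  + case: nr; apply: (shared_nearest (s := t) (t := s) mo mo' nt ns no') => //.
    * by move=> u; rewrite -(closed_period cc s) -E.
    * exact: nesym.
    * by apply/nesym; apply: (closed_simple cc); lra.
- case: nr; apply: (shared_nearest (s := s) (t := t) mo mo' ns nt no') => //.
    by rewrite -E.
  by apply: (closed_simple cc); lra.
Qed.

Lemma bitangent_halve s t : s < t -> t < s + L -> bitangent c d L s t ->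
  (exists2 r, s <= r <= t & supports_inner r) \/
  exists s' t', [/\ s <= s', s' < t', t' <= t, t' - s' <= (t - s) / 2 & bitangent c d L s' t'].
Proof.
move=> st tL [ o [mo ns nt]]; pose r := (s + t) / 2.
have sr : s < r by rewrite /r; lra.
have rt : r < t by rewrite /r; lra.
have [nr|nr] := pselect (nearest c o r).
  right; exists s, r; split => //; [exact: ltW|rewrite /r; lra|by exists o].
have [h|[r' [rr' r't b]]|[r' [sr' r'r b]]] := bitangent_trap mo ns nt sr rt tL nr.
- by left; exists r => //; rewrite !ltW.
- by right; exists r, r'; split; rewrite ?ltW//; rewrite /r; lra.
- by right; exists r', r; split; rewrite ?ltW//; rewrite /r; lra.
Qed.

(** If there were none, halving would give bitangent pairs on arbitrarily short arcs inside
    [[s, t]], while [bitangent_limit], made uniform by compactness, excludes all pairs closer than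
    some [r]. *)
Lemma bitangent_closed s t : s < t -> t < s + L -> bitangent c d L s t ->
  exists2 r, s <= r <= t & supports_inner r.
Proof.
move=> st tL bst; apply: contrapT => none.
have small (n : nat) : exists s' t', [/\ s <= s', s' < t', t' <= t,
    t' - s' <= (t - s) / 2 ^+ n & bitangent c d L s' t'].
  elim: n => [|n [s' [t' [ss' s't' t't le b]]]].
    by exists s, t; rewrite expr0 divr1; split.
  have t'L : t' < s' + L by lra.
  have [[r /andP[r1 r2] ir]|[s2 [t2 [h1 h2 h3 h4 b2]]]] := bitangent_halve s't' t'L b.
    by case: none; exists r => //; lra.
  exists s2, t2; split=> //; [lra|lra|].
  apply: le_trans h4 _; rewrite exprSr invfM mulrA.
  by rewrite ler_pM2r ?invr_gt0.
have ncov : near_covering `[s, t]%classic.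
  exact/compact_near_coveringP/segment_compact.
pose P r (x : R) := forall y : R, x < y -> y < x + r -> ~ bitangent c d L x y.
have near0 : \forall r \near at_right (0 : R), `[s, t]%classic `<=` P r.
  apply: ncov => x /=; rewrite in_itv /= => xst.
  have [|r r0 hr] := @bitangent_limit x; first by move=> h; apply: none; exists x.
  exists (ball x r, [set z | 0 < z < r]) => /=.
    split; first exact: nbhsx_ballx.
    by near=> z; apply/andP; split; near: z; [exact: nbhs_right_gt|exact: nbhs_right_lt].
  move=> [y z] /= [yx /andP[z0 zr]] u yu uz; apply: hr => //; last by lra.
  by move: yx; rewrite -ball_normE /= distrC.
have [r [/= r0 hr]] := filter_ex (filterI (nbhs_right_gt 0) near0).
pose n := Num.bound ((t - s) / r).
have h0 : 0 <= (t - s) / r by rewrite divr_ge0 ?(ltW r0)// subr_ge0 ltW.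
have n2 : (t - s) / 2 ^+ n < r.
  rewrite ltr_pdivrMr ?exprn_gt0// mulrC -ltr_pdivrMr//.
  apply: lt_le_trans (archi_boundP h0) _.
  by rewrite -natrX ler_nat ltnW// ltn_expl.
have [s' [t' [ss' s't' t't le b]]] := small n.
apply: (hr s' _ t' s't' _ b); last by lra.
by rewrite /= in_itv /= ss'; lra.
Unshelve. all: by end_near.
Qed.

(** Strictness comes from applying [bitangent_closed] to a smaller arc. An interior parameter that
    is no contact yields a pair strictly inside; if all interior parameters are contacts, the middle
    third serves. *)
Lemma bitangent_open s t : s < t -> t < s + L -> bitangent c d L s t ->
  exists r, [/\ s < r, r < t & supports_inner r].
Proof.
move=> st tL [ o [mo ns nt]].
have [[r [sr rt nr]]|all_near] := pselect (exists r, [/\ s < r, r < t & ~ nearest c o r]).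
  have [h|[r' [rr' r't b]]|[r' [sr' r'r b]]] := bitangent_trap mo ns nt sr rt tL nr.
  - by exists r.
  - have [|r2 /andP[h1 h2] h3] := bitangent_closed rr' _ b; first by lra.
    by exists r2; split=> //; lra.
  - have [|r2 /andP[h1 h2] h3] := bitangent_closed r'r _ b; first by lra.
    by exists r2; split=> //; lra.
have near r : s < r -> r < t -> nearest c o r.
  by move=> sr rt; apply: contrapT => nr; apply: all_near; exists r.
pose r1 := (2 * s + t) / 3; pose r2 := (s + 2 * t) / 3.
have [h1 h2 h3] : [/\ s < r1, r1 < r2 & r2 < t] by split; rewrite /r1 /r2; lra.
have b : bitangent c d L r1 r2 by exists o; split=> //; apply: near; lra.
have [|r /andP[rr1 rr2] hr] := bitangent_closed h2 _ b; first by lra.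
by exists r; split=> //; lra.
Qed.

Lemma two_inner_points : exists s t, [/\ c s <> c t, supports_inner s & supports_inner t].
Proof.
have L0 := closed_length cc.
have [all_inner|/existsNP[s ns]] := pselect (forall s, supports_inner s).
  exists 0, (L / 2); split; [|exact: all_inner|exact: all_inner].
  by apply: (closed_simple cc); lra.
have [//|[t [st tL bst]]] := medial_exists cc pos s.
have [s' [h1 h2 h3]] := bitangent_open st tL bst.
have bts : bitangent c d L t (s + L).
  have [ o [mo os ot]] := bst; exists o; split=> // u.
  by rewrite (closed_period cc); exact: os.
have [|t' [h4 h5 h6]] := bitangent_open tL _ bts; first by lra.
by exists s', t'; split=> //; apply: (closed_simple cc); lra.
Qed.

(** The last equation says that the second derivative of the squared distance to [o] vanishes at
    [s]. This form of osculation is unchanged when the curve is reversed. *)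
Lemma supports_inner_center s : supports_inner s -> exists o,
  [/\ medial c d L o, nearest c o s & sq (d s) + dot (e s) (c s - o) = 0].
Proof.
move=> sup; have v0 := speed_gt0 cc s; pose k := dot (e s) (perp (d s)).
have k0 : 0 < k.
  rewrite ltNge; apply/negP => k0; apply: (no_inner_halfplane cc pos (s := s) (k := k / sq (d s))).
    by rewrite mulr_le0_ge0// invr_ge0 ltW.
  move=> u; have := sup u; rewrite /osculating_form -/k subr_ge0 => h.
  by rewrite mulrAC ler_pdivlMr//; lra.
pose a := sq (d s) / k; have a0 : 0 < a by rewrite divr_gt0.
have no : nearest c (normal_point c d s a) s.
  apply/nearest_normalP => u; have := sup u; rewrite /osculating_form -/k subr_ge0 => h.
  rewrite /a [2 * _]mulrA mulrAC ler_pdivrMr//; lra.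
exists (normal_point c d s a); split=> //; first exact: (normal_medial cc pos a0 no).
have -> : dot (e s) (c s - normal_point c d s a) = - (a * k).
  by rewrite /k /dot /normal_point /perp /=; ring.
by rewrite /a divfK ?subrr// gt_eqF.
Qed.

End OneCurve.
End InnerPoints.

(** * Inversion *)

Section OuterPoints.
Variable R : realType.
Implicit Types (q o v x : R * R) (c d e : R -> R * R) (s t u r : R).

Lemma winding_reverse c d e (L : R) q : closed_curve c d e L -> ~ range c q ->
  winding (fun t => c (- t)) (fun t => - d (- t)) L q = - winding c d L q.
Proof.
move=> cc Gq; have L0 := ltW (closed_length cc).
have NL0 : - L <= 0 by rewrite oppr_le0.
have [F dF] := angle_primitive (closed_C1path cc) NL0 (fun t _ => off_curve (t := t) Gq).
have dG t : 0 <= t <= L ->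
    is_derive t 1 (fun t => F (- t)) (angle_form (fun t => c (- t)) (fun t => - d (- t)) q t).
  move=> /andP[t0 tL]; have hF : is_derive (- t) 1 F (angle_form c d q (- t)).
    by apply: dF; rewrite lerN2 tL oppr_le0.
  have -> : angle_form (fun t => c (- t)) (fun t => - d (- t)) q t =
      angle_form c d q (- t) * -1.
    by rewrite /angle_form mulrN1 -mulNr; congr (_ / _); rewrite /cross /=; ring.
  exact: (@is_derive1_comp _ F (fun t => - t) _ _ _ hF (is_deriveNid _ _)).
rewrite /winding (angleE L0 dG) oppr0.
by rewrite -/(winding c d L q) -(winding_shift cc (- L) Gq) addNr (angleE NL0 dF) opprB.
Qed.

(** Free of orientation, because it is applied to the inverted curve, whose orientation is not
    computed. *)
Lemma osculating_discs c d e (L : R) : closed_curve c d e L ->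
  exists s t, c s <> c t /\ forall u, u = s \/ u = t -> exists o,
    [/\ medial c d L o, nearest c o u & sq (d u) + dot (e u) (c u - o) = 0].
Proof.
move=> cc; have [pos|pos] := orientation cc.
  have [s [t [st hs ht]]] := two_inner_points cc pos.
  by exists s, t; split=> // u [->|->]; exact: supports_inner_center.
have rc := closed_curve_reverse cc.
have [s [t [st hs ht]]] := two_inner_points rc pos.
exists (- s), (- t); split=> // u us.
have {us} : supports_inner (fun t => c (- t)) (fun t => - d (- t)) (fun t => e (- t)) (- u).
  by case: us => ->; rewrite opprK.
move=> /(supports_inner_center rc pos)[ o [[Go wo] no]].
rewrite opprK => ho; exists o; split.
- have Go' : ~ range c o by rewrite -range_reverse.
  by split=> // wo'; apply: wo; rewrite (winding_reverse cc) // wo' oppr0.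
- by move=> y; have := no (- y); rewrite !opprK.
- by rewrite -ho; congr (_ + _); rewrite /sq /dot /=; ring.
Qed.

Section Inversion.
Variables (c d e : R -> R * R) (L : R) (z : R * R).
Hypotheses (cc : closed_curve c d e L) (zc : ~ range c z).

Let X t := c t - z.
Let S t := sq (X t).
Let S1 t := 2 * dot (d t) (X t).
Let S2 t := 2 * (sq (d t) + dot (e t) (X t)).

(** Inversion in the unit circle about [z], followed by the translation that takes [z] to the
    origin. *)
Definition invert x : R * R := ((x - z).1 / sq (x - z), (x - z).2 / sq (x - z)).

Definition inverted t := invert (c t).

Definition inverted1 t : R * R :=
  (((d t).1 * S t - (X t).1 * S1 t) / S t ^+ 2, ((d t).2 * S t - (X t).2 * S1 t) / S t ^+ 2).

Definition inverted2 t : R * R :=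
  ((((e t).1 * S t - (X t).1 * S2 t) * S t ^+ 2 -
    ((d t).1 * S t - (X t).1 * S1 t) * (2 * S t * S1 t)) / (S t ^+ 2) ^+ 2,
   (((e t).2 * S t - (X t).2 * S2 t) * S t ^+ 2 -
    ((d t).2 * S t - (X t).2 * S1 t) * (2 * S t * S1 t)) / (S t ^+ 2) ^+ 2).

Let S_neq0 t : S t != 0.
Proof. by rewrite gt_eqF//; exact/sqB_gt0/off_curve. Qed.

Let dX t : pderive X t (d t).
Proof. exact: pderiveB (closed_deriv cc t). Qed.

Let dS t : is_derive t 1 S (S1 t).
Proof. exact: is_derive_sqB cc z t. Qed.

Let dS1 t : is_derive t 1 S1 (S2 t).
Proof.
have h := is_derive_dot (closed_deriv2 cc t) (dX t).
by rewrite /S1; apply: is_derive_eq; rewrite /GRing.scale /= /S2 /sq; ring.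
Qed.

Let invert_deriv t : pderive inverted t (inverted1 t).
Proof.
have [h1 h2] := dX t.
by split; exact: is_derive_quot (S_neq0 t) _ (dS t).
Qed.

Let inverted1_deriv (f f' f'' : R -> R) t :
  is_derive t 1 f (f' t) -> is_derive t 1 f' (f'' t) ->
  is_derive t 1 (fun t => (f' t * S t - f t * S1 t) / S t ^+ 2)
  (((f'' t * S t - f t * S2 t) * S t ^+ 2 -
    (f' t * S t - f t * S1 t) * (2 * S t * S1 t)) / (S t ^+ 2) ^+ 2).
Proof.
move=> df df'; have h := dS t; have h1 := dS1 t.
have num : is_derive t 1 (fun t => f' t * S t - f t * S1 t) (f'' t * S t - f t * S2 t).
  by apply: is_derive_eq; rewrite /GRing.scale /=; ring.
have den : is_derive t 1 (fun t => S t ^+ 2) (2 * S t * S1 t).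
  by apply: is_derive_eq; rewrite /GRing.scale /=; ring.
by apply: is_derive_quot num den; rewrite expf_neq0.
Qed.

Let inverted2_continuous (f f' f'' : R -> R) :
  continuous f -> continuous f' -> continuous f'' ->
  continuous (fun t => ((f'' t * S t - f t * S2 t) * S t ^+ 2 -
    (f' t * S t - f t * S1 t) * (2 * S t * S1 t)) / (S t ^+ 2) ^+ 2).
Proof.
move=> cf cf' cf'' t.
have cS := is_derive_continuous (dS t); have cS1 := is_derive_continuous (dS1 t).
have [dx dy] := pderive_continuous (closed_deriv2 cc t).
have [Xx Xy] := pderive_continuous (dX t).
have ex := @closed_cont1 _ _ _ _ _ cc t; have ey := @closed_cont2 _ _ _ _ _ cc t.
have k2 : {for t, continuous (fun _ : R => 2 : R)} by exact: cvg_cst.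
have cS2 : {for t, continuous S2}.
  apply: (fun_continuousM k2); apply: fun_continuousD.
    exact: (fun_continuousD (fun_continuousM dx dx) (fun_continuousM dy dy)).
  exact: (fun_continuousD (fun_continuousM ex Xx) (fun_continuousM ey Xy)).
have cSS : {for t, continuous (fun t => S t ^+ 2)} := fun_continuousM cS cS.
have cSSSS : {for t, continuous (fun t => (S t ^+ 2) ^+ 2)} := fun_continuousM cSS cSS.
have S40 : (S t ^+ 2) ^+ 2 != 0 by rewrite !expf_neq0.
have f_t := cf t; have f'_t := cf' t; have f''_t := cf'' t.
have k1 := fun_continuousB (fun_continuousM f''_t cS) (fun_continuousM f_t cS2).
have k3 := fun_continuousB (fun_continuousM f'_t cS) (fun_continuousM f_t cS1).
have k4 := fun_continuousM (fun_continuousM k2 cS) cS1.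
exact: (fun_continuousM (fun_continuousB (fun_continuousM k1 cSS) (fun_continuousM k3 k4))
  (fun_continuousV cSSSS S40)).
Qed.

Let invert_inj x x' : x <> z -> x' <> z -> invert x = invert x' -> x = x'.
Proof.
move=> xz x'z.
have invK y : y <> z -> y = (z.1 + (invert y).1 / sq (invert y), z.2 + (invert y).2 / sq (invert y)).
  move=> yz; have y0 := lt0r_neq0 (sqB_gt0 yz).
  have E : sq (invert y) = (sq (y - z))^-1.
    rewrite /invert; move: y0; rewrite /sq /dot /= => y0; field.
    by rewrite y0.
  rewrite E invrK /invert /= !divfK// [LHS]surjective_pairing.
  by congr pair; rewrite addrC subrK.
by move=> E; rewrite (invK x xz) (invK x' x'z) E.
Qed.

Lemma inverted_closed : closed_curve inverted inverted1 inverted2 L.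
Proof.
split.
- exact: invert_deriv.
- move=> t; have [h1 h2] := dX t; have [k1 k2] := closed_deriv2 cc t.
  split; first exact: (@inverted1_deriv (fun t => (X t).1) (fun t => (d t).1) (fun t => (e t).1)).
  exact: (@inverted1_deriv (fun t => (X t).2) (fun t => (d t).2) (fun t => (e t).2)).
- apply: (@inverted2_continuous (fun t => (X t).1) (fun t => (d t).1) (fun t => (e t).1)).
  + by move=> t; have [] := pderive_continuous (dX t).
  + by move=> t; have [] := pderive_continuous (closed_deriv2 cc t).
  + exact: closed_cont1 cc.
- apply: (@inverted2_continuous (fun t => (X t).2) (fun t => (d t).2) (fun t => (e t).2)).
  + by move=> t; have [] := pderive_continuous (dX t).
  + by move=> t; have [] := pderive_continuous (closed_deriv2 cc t).
  + exact: closed_cont2 cc.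
- exact: closed_length cc.
- by move=> t; rewrite /inverted (closed_period cc).
- move=> t u tu uL E; apply: (closed_simple cc tu uL).
  by apply: invert_inj E; exact: off_curve.
- move=> t [/eqP E1 /eqP E2]; apply: (closed_regular cc (t := t)).
  move: E1 E2; rewrite !mulf_eq0 !invr_eq0 !expf_eq0 /= (negPf (S_neq0 t)) !orbF.
  rewrite !subr_eq0 => /eqP E1 /eqP E2.
  (* Taking the dot product of [d t * S t = X t * S1 t] with [2 * X t] gives
     [S t * S1 t = 2 * (S t * S1 t)]. *)
  have E : S t * S1 t = 0.
    have : S t * S1 t = 2 * (S t * S1 t); last by lra.
    transitivity (2 * ((d t).1 * S t * (X t).1 + (d t).2 * S t * (X t).2)).
      by rewrite /S1 /dot; ring.
    by rewrite E1 E2 /S /X /sq /dot /=; ring.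
  have S10 : S1 t = 0 by apply: (mulfI (S_neq0 t)); rewrite mulr0.
  rewrite [LHS]surjective_pairing; congr pair; apply: (mulIf (S_neq0 t)).
    by rewrite E1 S10 mulr0 mul0r.
  by rewrite E2 S10 mulr0 mul0r.
Qed.

Lemma inverted_range x : x <> z -> ~ range c x -> ~ range inverted (invert x).
Proof.
by move=> xz Gx [t _ E]; apply: Gx; exists t => //; apply: invert_inj E => //; exact: off_curve.
Qed.

(* In complex notation the inverted curve is the conjugate of 1 / (c - z), so
   that its argument about an inverted point is a difference of arguments. *)
Lemma inverted_winding x : x <> z -> ~ range c x ->
  winding inverted inverted1 L (invert x) = winding c d L z - winding c d L x.
Proof.
move=> xz Gx; have L0 := ltW (closed_length cc).
have [F dF] := angle_primitive (closed_C1path cc) L0 (fun t _ => off_curve (t := t) zc).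
have [G dG] := angle_primitive (closed_C1path cc) L0 (fun t _ => off_curve (t := t) Gx).
have dFG t : 0 <= t <= L ->
    is_derive t 1 (fun t => F t - G t) (angle_form inverted inverted1 (invert x) t).
  move=> tL; have h1 := dF t tL; have h2 := dG t tL.
  apply: (is_derive_eq (is_deriveB h1 h2)).
  have T0 := lt0r_neq0 (sqB_gt0 xz).
  have cx0 := lt0r_neq0 (sqB_gt0 (off_curve (t := t) Gx)).
  have s0 := S_neq0 t.
  have den : sq (inverted t - invert x) = sq (c t - x) / (S t * sq (x - z)).
    move: s0 T0; rewrite /inverted /invert /S /X /sq /dot /= => s0 T0; field.
    by rewrite s0 andbT; exact: T0.
  have num : cross (inverted t - invert x) (inverted1 t) =
      (cross (c t - z) (d t) * sq (c t - x) - cross (c t - x) (d t) * S t) /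
      (S t ^+ 2 * sq (x - z)).
    move: s0 T0; rewrite /inverted1 /inverted /invert /S1 /S /X /cross /sq /dot /= => s0 T0; field.
    by rewrite s0 andbT; exact: T0.
  rewrite /angle_form den num -/(X t) -/(S t).
  field.
  by rewrite cx0 s0 T0.
rewrite /winding (angleE L0 dFG) (angleE L0 dF) (angleE L0 dG); ring.
Qed.

End Inversion.
End OuterPoints.

(** * Supporting circlines *)

Section Supports.
Variable R : realType.
Implicit Types (q o v x : R * R) (c d e : R -> R * R) (s t u r : R).

(** The hypotheses say that the quadratic function on the left has vanishing first and second
    derivative along [c] at [s], which determines it up to a factor. The proof adds multiples of the
    two vanishing expressions to reach a polynomial identity. *)
Lemma contact_form c d e s (A : R) v q :
  dot v (d s) = 0 -> 2 * A * sq (d s) + dot v (e s) = 0 ->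
  2 * sq (d s) ^+ 2 * (A * sq (q - c s) + dot v (q - c s)) =
  - dot v (perp (d s)) * osculating_form c d e s q.
Proof.
move=> h1 h2; rewrite -[RHS]addr0.
rewrite -(mul0r (2 * sq (d s) * dot (d s) (q - c s) - dot (d s) (e s) * sq (q - c s))) -{1}h1.
rewrite -[RHS]addr0 -(mul0r (sq (d s) * sq (q - c s))) -{1}h2.
by rewrite /osculating_form /perp /sq /dot /=; ring.
Qed.

Lemma contact_nonzero d s v : dot v (d s) = 0 -> d s <> 0 ->
  dot v (perp (d s)) = 0 -> v = 0.
Proof.
move=> h1 /eqP ds h2; have v0 : sq (d s) != 0 by rewrite sq_eq0.
rewrite [LHS]surjective_pairing; congr pair; apply: (mulIf v0); rewrite mul0r.
  transitivity (dot v (d s) * (d s).1 - dot v (perp (d s)) * (d s).2).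
    by rewrite /sq /dot /perp /=; ring.
  by rewrite h1 h2 !mul0r subr0.
transitivity (dot v (d s) * (d s).2 + dot v (perp (d s)) * (d s).1).
  by rewrite /sq /dot /perp /=; ring.
by rewrite h1 h2 !mul0r addr0.
Qed.

Section OneCurve.
Variables (c d e : R -> R * R) (L : R).
Hypothesis cc : closed_curve c d e L.

(** Three situations at once: the curve lies in the closed osculating disc if the curvature is
    positive, in the closed half-plane left of the tangent if it is zero, and avoids the open
    osculating disc if it is negative. *)
Definition supports_outer s := forall u, osculating_form c d e s (c u) <= 0.

Lemma osculating_form_center s q : dot (e s) (perp (d s)) != 0 ->
  osculating_form c d e s q = dot (e s) (perp (d s)) *
  (sq (q - normal_point c d s (sq (d s) / dot (e s) (perp (d s)))) -
   sq (c s - normal_point c d s (sq (d s) / dot (e s) (perp (d s))))).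
Proof.
set k := dot _ _ => k0.
have E (a : R) : sq (q - normal_point c d s a) - sq (c s - normal_point c d s a) =
    sq (q - c s) - 2 * a * dot (q - c s) (perp (d s)).
  by rewrite /sq /dot /normal_point /perp /=; ring.
rewrite E /osculating_form -/k; field.
exact: k0.
Qed.

Lemma sq_normal_point s a : sq (c s - normal_point c d s a) = a ^+ 2 * sq (d s).
Proof. by rewrite /sq /dot /normal_point /=; ring. Qed.

Lemma osculating_circline_inside s q : positively_oriented c d L ->
  supports_inner c d e s -> osculating_form c d e s q = 0 ->
  bounded_closed_region (range c) q.
Proof.
move=> pos sup q0; have [Gq|Gq] := pselect (range c q); first by right.
left; have [ o [mo no oE]] := supports_inner_center cc pos sup.
have [a a0 oa] := medial_center cc pos mo no.
have v0 := speed_gt0 cc s.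
have aE : sq (d s) = a * dot (e s) (perp (d s)).
  apply/eqP; rewrite -subr_eq0 -oE oa; apply/eqP.
  by rewrite /dot /normal_point /perp /=; ring.
have k0 : dot (e s) (perp (d s)) != 0.
  by apply/eqP => k0; move: v0; rewrite aE k0 mulr0 ltxx.
have qo : sq (q - o) = sq (c s - o).
  move/eqP: q0; rewrite osculating_form_center// aE mulfK// -oa.
  by rewrite mulf_eq0 (negPf k0) subr_eq0 => /eqP.
have [Go wo] := mo; apply: (winding_inside cc Gq).
by rewrite (nearest_winding cc no Go Gq) // qo.
Qed.

Lemma osculating_circline_outside s q : positively_oriented c d L ->
  supports_outer s -> osculating_form c d e s q = 0 ->
  unbounded_closed_region (range c) q.
Proof.
move=> pos sup q0; have [Gq|Gq] := pselect (range c q); first by right.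
left; have v0 := speed_gt0 cc s; set k := dot (e s) (perp (d s)).
pose a := sq (d s) / k; pose o := normal_point c d s a.
have oE y : k != 0 -> osculating_form c d e s y = k * (sq (y - o) - a ^+ 2 * sq (d s)).
  by move=> k0; rewrite osculating_form_center// -/k -/a -/o sq_normal_point.
have off y : 0 < osculating_form c d e s y -> ~ range c y.
  by move=> y0 [u _ E]; have := sup u; rewrite E leNgt y0.
have ray v : v != 0 ->
    (forall t, 0 < t -> 0 < osculating_form c d e s (q.1 + t * v.1, q.2 + t * v.2)) ->
    outside (range c) q.
  move=> vn0 h; apply: (outside_ray vn0) => t t0.
  have [->|tn0] := eqVneq t 0; first by rewrite !mul0r !addr0 -surjective_pairing.
  by apply/off/h; rewrite lt_def tn0.
have [k0|k0|k0] := ltgtP k 0.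
(* The osculating disc is on the right of the curve, with no curve point in its interior; segments
   to its centre join [q] to a right-hand normal point, which is outside. *)
- have kn0 : k != 0 by rewrite lt_eqF.
  have a0 : a < 0 by rewrite /a pmulr_rlt0// invr_lt0.
  have no : nearest c o s.
    move=> u; have := sup u; rewrite oE// nmulr_rle0// subr_ge0.
    by rewrite /o sq_normal_point.
  have Go : ~ range c o.
    apply: (nearest_ball no); rewrite /o sq_normal_point [X in X < _](_ : _ = 0).
      by apply: mulr_gt0 => //; rewrite exprn_even_gt0//= lt_eqF.
    by rewrite /sq /dot /= !subrr mul0r addr0.
  have [r [W [r0 _ posr]]] := pos.
  pose b := Num.min (r / 2) (- a).
  have [b0 br ba] : [/\ 0 < b, b < r & b <= - a].
    have b1 : b <= r / 2 by rewrite ge_min lexx.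
    by split; [rewrite lt_min divr_gt0// oppr_gt0|lra|rewrite ge_min lexx orbT].
  have [_ _ out] := posr s b b0 br.
  have seg y : ~ range c y -> sq (y - o) <= sq (c s - o) -> exists X : set (R * R),
      [/\ connected X, X `<=` ~` range c, X y & X o].
    move=> Gy yo; exists [set (y.1 + t * (o - y).1, y.2 + t * (o - y).2) | t in `[0, 1 : R]].
    split; first exact: plane_segment_connected.
    - by move=> _ [t /= + <-]; rewrite in_itv /=; exact: (nearest_segment no Go Gy yo).
    - by exists 0; [rewrite /= in_itv /= lexx ler01|rewrite !mul0r !addr0 -surjective_pairing].
    - exists 1; first by rewrite /= in_itv /= lexx ler01.
      by rewrite [RHS]surjective_pairing; congr pair; rewrite /=; ring.
  have [||X [cX XG Xy Xo]] := seg (normal_point c d s (- b)).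
  + by case: out.
  + rewrite [X in X <= _](_ : _ = (- a - b) ^+ 2 * sq (d s)).
      rewrite /o sq_normal_point ler_pM2r// -[a ^+ 2]sqrrN ler_sqr ?nnegrE; lra.
    by rewrite /o /sq /dot /normal_point /=; ring.
  have oout := outside_connected cX XG Xy Xo out.
  have [//||Y [cY YG Yq Yo]] := seg q.
    have /eqP := q0; rewrite oE// mulf_eq0 (negPf kn0) subr_eq0 => /eqP ->.
    by rewrite /o sq_normal_point.
  exact: (outside_connected cY YG Yo Yq oout).
(* The curve lies in the closed osculating disc, which the radial ray from [q] leaves at once. *)
- have kn0 : k != 0 by rewrite gt_eqF.
  have qo : sq (q - o) = a ^+ 2 * sq (d s).
    by have /eqP := q0; rewrite oE// mulf_eq0 (negPf kn0) subr_eq0 => /eqP.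
  have a0 : 0 < a by rewrite divr_gt0.
  have R0 : 0 < a ^+ 2 * sq (d s) by rewrite mulr_gt0// exprn_gt0.
  apply: (ray (q - o)); first by rewrite -sq_gt0 qo.
  move=> t t0; rewrite oE// pmulr_rgt0//.
  have -> : sq ((q.1 + t * (q - o).1, q.2 + t * (q - o).2) - o) = (1 + t) ^+ 2 * sq (q - o).
    by rewrite /sq /dot /=; ring.
  rewrite qo; have : 0 < t * (a ^+ 2 * sq (d s)) by rewrite mulr_gt0.
  have : 0 < t ^+ 2 * (a ^+ 2 * sq (d s)) by rewrite mulr_gt0// exprn_gt0.
  lra.
(* The curve lies on the left of the tangent line, so the ray to the right escapes. *)
- apply: (ray (- perp (d s))).
    by rewrite oppr_eq0 -sq_gt0 sq_perp.
  move=> t t0; move: q0; rewrite /osculating_form -/k k0 !mul0r !sub0r => q0.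
  have -> : dot ((q.1 + t * (- perp (d s)).1, q.2 + t * (- perp (d s)).2) - c s) (perp (d s)) =
      dot (q - c s) (perp (d s)) - t * sq (d s).
    by rewrite /sq /dot /perp /=; ring.
  have : 0 < t * sq (d s) * sq (d s) by rewrite !mulr_gt0.
  lra.
Qed.

Lemma same_osculating_form s t : c s = c t ->
  osculating_form c d e s =1 osculating_form c d e t.
Proof.
move=> st q; have [u [su usL uc ud ue]] := closed_window cc s t.
suff E : s = u by rewrite /osculating_form E uc ud ue.
apply/eqP; rewrite eq_le su /= leNgt; apply/negP => lsu.
by apply: (closed_simple cc lsu usL); rewrite uc.
Qed.

(* If the osculating circlines supporting c from both sides coincide, then c
   runs along that circline and so osculates it everywhere. *)
Lemma osculating_form_vanishes s : (forall u, osculating_form c d e s (c u) = 0) ->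
  forall t u, osculating_form c d e t (c u) = 0.
Proof.
move=> h t u; set k := dot (e s) (perp (d s)).
(* [v u] is the gradient at [c u] of the osculating form at [s]. As that form vanishes along [c],
   differentiating twice gives the contact conditions at every [t], and [contact_form] applies with
   leading coefficient [k]. *)
pose v u := (2 * k * (c u - c s).1 - 2 * sq (d s) * (perp (d s)).1,
             2 * k * (c u - c s).2 - 2 * sq (d s) * (perp (d s)).2).
have v0 := speed_gt0 cc s; have vt0 := speed_gt0 cc t.
have D1 y : dot (v y) (d y) = 0.
  have h1 := pderiveB (c s) (closed_deriv cc y).
  have h2 := is_derive_dot h1 h1; have h3 := is_derive_dotr (perp (d s)) h1.
  have : is_derive y 1 (fun u => osculating_form c d e s (c u)) (dot (v y) (d y)).
    rewrite /osculating_form -/k /sq; apply: is_derive_eq.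
    by rewrite /GRing.scale /= /v /sq /dot /=; ring.
  move=> D; apply: (is_derive_unique D); under eq_fun do rewrite h.
  exact: is_derive_cst.
have D2 : 2 * k * sq (d t) + dot (v t) (e t) = 0.
  have [h1 h2] := pderiveB (c s) (closed_deriv cc t).
  have [h3 h4] := closed_deriv2 cc t.
  have : is_derive t 1 (fun u => dot (v u) (d u)) (2 * k * sq (d t) + dot (v t) (e t)).
    rewrite /v /dot /=; apply: is_derive_eq.
    by rewrite /GRing.scale /= /sq /dot /=; ring.
  move=> D; apply: (is_derive_unique D); under eq_fun do rewrite D1.
  exact: is_derive_cst.
have := contact_form c (c u) (D1 t) D2.
have -> : k * sq (c u - c t) + dot (v t) (c u - c t) =
    osculating_form c d e s (c u) - osculating_form c d e s (c t).
  by rewrite /osculating_form -/k /v /sq /dot /=; ring.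
rewrite !h subrr mulr0 => /esym/eqP; rewrite mulf_eq0 oppr_eq0 => /orP[/eqP m0|/eqP//].
(* A zero proportionality factor would make the gradient vanish at [c t]; this forces [k = 0], and
   then the form is affine with a nonzero constant gradient. *)
have vt := contact_nonzero (D1 t) (closed_regular cc (t := t)) m0.
have k0 : k = 0.
  move: D2; rewrite vt; have -> : dot 0 (e t) = 0 by rewrite /dot /= !mul0r addr0.
  by rewrite addr0 => /eqP; rewrite !mulf_eq0 pnatr_eq0 (gt_eqF vt0) orbF => /eqP.
have : dot (v t) (perp (d s)) = 0 by rewrite vt /dot /= !mul0r addr0.
have -> : dot (v t) (perp (d s)) = 2 * k * dot (c t - c s) (perp (d s)) - 2 * sq (d s) ^+ 2.
  by rewrite /v /sq /dot /perp /=; ring.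
rewrite k0 mulr0 mul0r sub0r => /eqP; rewrite oppr_eq0 mulf_eq0 pnatr_eq0 expf_eq0 /=.
by rewrite (gt_eqF v0).
Qed.

End OneCurve.
End Supports.

(** * Outer support points by inversion, and the four points *)

Section FourPoints.
Variable R : realType.
Implicit Types (q o v x z : R * R) (c d e : R -> R * R) (s t u r : R).

(* Pulling back the osculating disc of the inverted curve gives a quadratic
   function G that is nonnegative on c; the winding numbers exclude that G is
   negative on the inner side of c. *)
Lemma inverted_supports_outer c d e (L : R) z s : closed_curve c d e L ->
  ~ range c z ->
  (exists r, 0 < r /\ forall a, 0 < a -> a < r -> ~ range c (normal_point c d s a) /\
     winding c d L (normal_point c d s a) = winding c d L z) ->
  (exists o, [/\ medial (inverted c z) (inverted1 c d z) L o, nearest (inverted c z) o s &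
     sq (inverted1 c d z s) + dot (inverted2 c d e z s) (inverted c z s - o) = 0]) ->
  supports_outer c d e s.
Proof.
move=> cc zc [r [r0 left_side]] [ o [[Go wo] no oE]].
have ic := inverted_closed cc zc; have v0 := speed_gt0 cc s.
pose X u := c u - z; pose S u := sq (X u).
have S0 u : 0 < S u by exact/sqB_gt0/off_curve.
pose ci := inverted c z; pose di := inverted1 c d z; pose ei := inverted2 c d e z.
(* Away from [z], [G x] is [sq (x - z)] times the power of the inverted point with respect to the
   osculating circle of the inverted curve. Expanded, it is a polynomial that also makes sense at
   [z], where it equals 1. *)
pose A := sq o - sq (ci s - o).
pose G x := 1 - 2 * dot o (x - z) + A * sq (x - z).
have GE x : x <> z -> G x = sq (x - z) * (sq (invert z x - o) - sq (ci s - o)).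
  move=> /sqB_gt0/lt0r_neq0; rewrite /G /A /invert.
  move: (sq (ci s - o)) => y; rewrite /sq /dot /= => x0; field.
  exact: x0.
have Gc u : G (c u) = S u * (sq (ci u - o) - sq (ci s - o)).
  by apply: GE; exact: off_curve.
have Gge0 u : 0 <= G (c u) by rewrite Gc mulr_ge0 ?(ltW (S0 u))// subr_ge0.
pose v u := (2 * A * (X u).1 - 2 * o.1, 2 * A * (X u).2 - 2 * o.2).
have dX u : pderive X u (d u) := pderiveB z (closed_deriv cc u).
have dci u : pderive (fun u => ci u - o) u (di u) := pderiveB o (closed_deriv ic u).
have dG u : is_derive u 1 (fun u => G (c u)) (dot (v u) (d u)).
  have h1 := is_derive_dot (dX u) (dX u); have h2 := is_derive_dotl o (dX u).
  have -> : (fun u => G (c u)) = (fun u => 1 - 2 * dot o (X u) + A * dot (X u) (X u)) by [].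
  by apply: is_derive_eq; rewrite /GRing.scale /= /v /dot /=; ring.
(* The factored form of [G] along [c] gives the same derivative in terms of the inverted curve,
   where its contact conditions at [s] can be used. *)
have dG' u : is_derive u 1 (fun u => G (c u))
    (2 * dot (d u) (X u) * (sq (ci u - o) - sq (ci s - o)) + S u * (2 * dot (di u) (ci u - o))).
  under eq_fun do rewrite Gc.
  have h1 := is_derive_dot (dX u) (dX u); have h2 := is_derive_dot (dci u) (dci u).
  by rewrite /S /sq; apply: is_derive_eq; rewrite /GRing.scale /= /dot /=; ring.
have vE u : dot (v u) (d u) = 2 * dot (d u) (X u) * (sq (ci u - o) - sq (ci s - o)) +
    S u * (2 * dot (di u) (ci u - o)) := is_derive_unique (dG u) (dG' u).
have crit : dot (di s) (ci s - o) = 0 := nearest_critical ic no.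
have D1 : dot (v s) (d s) = 0 by rewrite vE crit subrr !mulr0 addr0.
have D2 : 2 * A * sq (d s) + dot (v s) (e s) = 0.
  have [h1 h2] := dX s; have [h3 h4] := closed_deriv2 cc s.
  have D : is_derive s 1 (fun u => dot (v u) (d u)) (2 * A * sq (d s) + dot (v s) (e s)).
    rewrite /v /dot /=; apply: is_derive_eq.
    by rewrite /GRing.scale /= /sq /dot /=; ring.
  apply: (is_derive_unique D); under eq_fun do rewrite vE.
  have k1 := is_derive_dot (dX s) (dX s); have k2 := is_derive_dot (dci s) (dci s).
  have k3 := is_derive_dot (closed_deriv2 cc s) (dX s).
  have k4 := is_derive_dot (closed_deriv2 ic s) (dci s).
  rewrite /S /sq; apply: is_derive_eq.
  have crit' : dot (ci s - o) (di s) = 0 by rewrite -crit /dot; ring.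
  have oE' : dot (inverted2 c d e z s) (ci s - o) + dot (inverted1 c d z s) (di s) = 0.
    by rewrite -oE addrC.
  by rewrite /GRing.scale /= !subrr oE' crit crit'; ring.
have contact x : 2 * sq (d s) ^+ 2 * G x = - dot (v s) (perp (d s)) * osculating_form c d e s x.
  rewrite -(contact_form c x D1 D2); congr (_ * _).
  have : G (c s) = 0 by rewrite Gc subrr mulr0.
  rewrite /G /v /X /sq /dot /= => h; rewrite -[LHS]subr0 -h; ring.
have vv0 : 0 < 2 * sq (d s) ^+ 2 by rewrite mulr_gt0// exprn_gt0.
have [m0|m0|m0] := ltgtP (dot (v s) (perp (d s))) 0.
(* With this sign [G] is negative just to the left of [c s]: [a] is small enough for the linear term
   of [osculating_form] to prevail. The inverted point is then in the disc about [o], yet its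
   winding number is that of [z] minus that of [x], hence 0. *)
- exfalso; pose k := dot (e s) (perp (d s)).
  pose a := Num.min (r / 2) (sq (d s) / (1 + `|k|)).
  have k1 : 0 < 1 + `|k| by rewrite ltr_wpDr.
  have a0 : 0 < a by rewrite lt_min !divr_gt0.
  have ar : a < r by have : a <= r / 2 by [rewrite ge_min lexx]; lra.
  have ak : a * k < 2 * sq (d s).
    have : a <= sq (d s) / (1 + `|k|) by rewrite ge_min lexx orbT.
    rewrite ler_pdivlMr// => h; have : a * k <= a * `|k| by rewrite ler_pM2l// ler_norm.
    lra.
  have [Gx wx] := left_side a a0 ar; set x := normal_point c d s a in Gx wx.
  have oscx : osculating_form c d e s x < 0.
    have -> : osculating_form c d e s x = a * sq (d s) * (a * k - 2 * sq (d s)).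
      by rewrite /osculating_form /x /k /sq /dot /normal_point /perp /=; ring.
    by rewrite pmulr_rlt0 ?mulr_gt0// subr_lt0.
  have Gx0 : G x < 0.
    by rewrite -(pmulr_rlt0 _ vv0) contact pmulr_rlt0// oppr_gt0.
  have xz : x <> z.
    move=> E; move: Gx0; rewrite E /G subrr /sq /dot /= !mulr0 !addr0 mulr0 subr0 mulr0 addr0.
    by rewrite ltr10.
  have lt : sq (invert z x - o) < sq (ci s - o).
    by move: Gx0; rewrite (GE x xz) pmulr_rlt0 ?sqB_gt0// subr_lt0.
  apply: wo; rewrite -(nearest_winding ic no Go (inverted_range zc xz Gx) (ltW lt)).
  by rewrite (inverted_winding cc zc xz Gx) wx subrr.
- move=> u; have := Gge0 u; rewrite -(pmulr_rge0 _ vv0) contact.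
  by rewrite nmulr_rge0// oppr_lt0.
(* A zero gradient forces [A = 0] and [o = 0], so that [G] would be constantly 1, although it
   vanishes at [c s]. *)
- exfalso; have vs := contact_nonzero D1 (closed_regular cc (t := s)) m0.
  have A0 : A = 0.
    move: D2; rewrite vs; have -> : dot 0 (e s) = 0 by rewrite /dot /= !mul0r addr0.
    by rewrite addr0 => /eqP; rewrite !mulf_eq0 pnatr_eq0 (gt_eqF v0) orbF => /eqP.
  have : G (c s) = 0 by rewrite Gc subrr mulr0.
  have [oo1 oo2] : o.1 = 0 /\ o.2 = 0.
    by have := congr1 fst vs; have := congr1 snd vs; rewrite /v A0 /=; split; lra.
  rewrite /G A0 /dot oo1 oo2 !mul0r !addr0 mulr0 subr0 => /eqP.
  by rewrite oner_eq0.
Qed.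

Lemma two_outer_points c d e (L : R) : closed_curve c d e L -> positively_oriented c d L ->
  exists s t, [/\ c s <> c t, supports_outer c d e s & supports_outer c d e t].
Proof.
move=> cc [r [W [r0 _ posr]]].
have r2 : 0 < r / 2 by rewrite divr_gt0.
have r2r : r / 2 < r by lra.
have [zc wz _] := posr 0 (r / 2) r2 r2r; set z := normal_point c d 0 (r / 2) in zc wz.
have [s [t [st ht]]] := osculating_discs (inverted_closed cc zc).
have left_side u : exists r, 0 < r /\ forall a, 0 < a -> a < r ->
    ~ range c (normal_point c d u a) /\
    winding c d L (normal_point c d u a) = winding c d L z.
  exists r; split=> // a a0 ar; have [h1 h2 _] := posr u a a0 ar.
  by rewrite h2 wz.
exists s, t; split.
- by move=> E; apply: st; rewrite /inverted E.
- by apply: (inverted_supports_outer cc zc (left_side s)); apply: ht; left.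
- by apply: (inverted_supports_outer cc zc (left_side t)); apply: ht; right.
Qed.

Definition zero_set_in c d e s (A : set (R * R)) :=
  forall q, osculating_form c d e s q = 0 -> A q.

Lemma four_points_oriented c d e (L : R) : closed_curve c d e L -> positively_oriented c d L ->
  exists s1 s2 t1 t2, uniq [:: c s1; c s2; c t1; c t2] /\
    [/\ zero_set_in c d e s1 (bounded_closed_region (range c)),
        zero_set_in c d e s2 (bounded_closed_region (range c)),
        zero_set_in c d e t1 (unbounded_closed_region (range c)) &
        zero_set_in c d e t2 (unbounded_closed_region (range c))].
Proof.
move=> cc pos.
have [s1 [s2 [s12 i1 i2]]] := two_inner_points cc pos.
have [t1 [t2 [t12 o1 o2]]] := two_outer_points cc pos.
have inn s : supports_inner c d e s -> zero_set_in c d e s (bounded_closed_region (range c)).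
  by move=> h q; exact: (osculating_circline_inside cc pos h).
have out s : supports_outer c d e s -> zero_set_in c d e s (unbounded_closed_region (range c)).
  by move=> h q; exact: (osculating_circline_outside cc pos h).
have [[s [t [st si so]]]|none] := pselect (exists s t, [/\ c s = c t,
    supports_inner c d e s & supports_outer c d e t]).
  have van : forall t u, osculating_form c d e t (c u) = 0.
    apply: (osculating_form_vanishes cc (s := s)) => u; apply/eqP.
    by rewrite eq_le si (same_osculating_form cc st) so.
  have L0 := closed_length cc.
  exists 0, (L / 4), (L / 2), (3 * L / 4); split.
    have neq (x y : R) : 0 <= x -> x < y -> y < L -> c x != c y.
      by move=> x0 xy yL; apply/eqP; apply: (closed_simple cc xy); lra.
    have n1 : c 0 != c (L / 4) by apply: neq; lra.
    have n2 : c 0 != c (L / 2) by apply: neq; lra.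
    have n3 : c 0 != c (3 * L / 4) by apply: neq; lra.
    have n4 : c (L / 4) != c (L / 2) by apply: neq; lra.
    have n5 : c (L / 4) != c (3 * L / 4) by apply: neq; lra.
    have n6 : c (L / 2) != c (3 * L / 4) by apply: neq; lra.
    by rewrite /= !inE !negb_or n1 n2 n3 n4 n5 n6.
  by split; [apply: inn|apply: inn|apply: out|apply: out] => u; rewrite van.
exists s1, s2, t1, t2; split; last first.
  by split; [apply: inn|apply: inn|apply: out|apply: out].
have neq s t : supports_inner c d e s -> supports_outer c d e t -> c s != c t.
  by move=> h1 h2; apply/eqP => E; apply: none; exists s, t.
move/eqP in s12; move/eqP in t12.
by rewrite /= !inE !negb_or s12 t12 !neq.
Qed.

Lemma four_points c d e (L : R) : closed_curve c d e L ->
  exists s1 s2 t1 t2, uniq [:: c s1; c s2; c t1; c t2] /\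
    [/\ zero_set_in c d e s1 (bounded_closed_region (range c)),
        zero_set_in c d e s2 (bounded_closed_region (range c)),
        zero_set_in c d e t1 (unbounded_closed_region (range c)) &
        zero_set_in c d e t2 (unbounded_closed_region (range c))].
Proof.
move=> cc; have [pos|pos] := orientation cc; first exact: four_points_oriented cc pos.
have rc := closed_curve_reverse cc.
have [s1 [s2 [t1 [t2 [un]]]]] := four_points_oriented rc pos.
rewrite range_reverse => -[h1 h2 h3 h4].
have rev s (A : set (R * R)) : zero_set_in (fun t => c (- t)) (fun t => - d (- t)) (fun t => e (- t)) s A ->
    zero_set_in c d e (- s) A.
  move=> h q q0; apply: h; rewrite -[RHS]oppr0 -q0.
  by rewrite /osculating_form /sq /dot /perp /=; ring.
by exists (- s1), (- s2), (- t1), (- t2); split=> //; split; exact: rev.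
Qed.

Lemma smooth_closed_curve (g : R -> R * R) (L : R) :
  regular_smooth_curve g -> closed_simple_curve g L ->
  closed_curve g (velocity g) (acceleration g) L.
Proof.
move=> [sx sy reg] [L0 per simp].
have cont2 (f : R -> R) : smooth f -> continuous (f^`(2)).
  by move=> sf t; exact: is_derive_continuous (derivableP (sf 2%N t)).
apply: ClosedCurve; [| | | |exact: L0|exact: per| |].
- by move=> t; split; [exact: (smooth_derive t sx)|exact: (smooth_derive t sy)].
- by move=> t; split; [exact: (smooth_derive2 t sx)|exact: (smooth_derive2 t sy)].
- exact: (cont2 _ sx).
- exact: (cont2 _ sy).
(* After [t] is shifted into [[0, L)], [u] lies below [2 * L] and may have to be moved back by one
   more period. *)
- move=> t u tu uL E.
  have [n n1 n2] := periodic_window 0 t L0; rewrite add0r in n2.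
  have Et := periodic_int per n t; have Eu := periodic_int per n u.
  have [uL'|Lu] := ltP (u + n%:~R * L) L.
    have : t + n%:~R * L = u + n%:~R * L.
      by apply: simp; rewrite ?Et ?Eu//; apply/andP; split; lra.
    lra.
  have Eu' := per (u + n%:~R * L - L); rewrite subrK in Eu'.
  have : t + n%:~R * L = u + n%:~R * L - L.
    by apply: simp; rewrite -?Eu' ?Et ?Eu//; apply/andP; split; lra.
  lra.
- by move=> t; exact/eqP.
Qed.

Lemma osculating_formulaE (g : R -> R * R) t : velocity g t != 0 ->
  osculating_formula g t =
  [set q | osculating_form g (velocity g) (acceleration g) t q = 0].
Proof.
rewrite -sq_gt0 => v0; rewrite /osculating_formula /osculating_form.
have -> : signed_curvature g t = dot (acceleration g t) (perp (velocity g t)) /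
    Num.sqrt (sq (velocity g t)) ^+ 3.
  by rewrite /signed_curvature /sq /dot /perp /= -!expr2; congr (_ / _); ring.
have -> : unit_tangent g t = (Num.sqrt (sq (velocity g t)))^-1 *: velocity g t.
  by rewrite /unit_tangent /sq /dot -!expr2.
set k := dot _ _; set v := velocity g t in v0 *.
have s0 : 0 < Num.sqrt (sq v) by rewrite sqrtr_gt0.
have s2 : Num.sqrt (sq v) ^+ 2 = sq v by rewrite sqr_sqrtr// ltW.
move: (Num.sqrt (sq v)) s0 s2 => r r0 r2; have rn0 := lt0r_neq0 r0.
rewrite mulf_eq0 invr_eq0 expf_eq0 /= (negPf rn0) orbF.
have eqv (y y' y'' m : R) : m != 0 -> y'' = m * (y - y') -> (y = y') = (y'' = 0).
  move=> m0 ->; apply/propext; split=> [->|/eqP]; first by rewrite subrr mulr0.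
  by rewrite mulf_eq0 (negPf m0) subr_eq0 => /eqP.
have [k0|k0] := eqVneq k 0; apply/funext => q /=.
  apply: (eqv _ _ _ (- 2 * sq v * r)).
    by rewrite !mulf_neq0// ?oppr_eq0 ?pnatr_eq0// gt_eqF.
  rewrite k0 /dot /perp /= /GRing.scale /=; move: (sq v) => w; field.
  exact: rn0.
apply: (eqv _ _ _ k) => //.
rewrite -r2; move: r2; rewrite /sq /dot /perp /= /GRing.scale /=.
move: k0 q (g t) v {v0} => k0 [x y] [p1 p2] [v1 v2] /= /eqP; rewrite -subr_eq0 => /eqP r2.
(* The identity holds only modulo [r ^+ 2 = sq v]; [r ^+ 4 / k] is the cofactor of this relation. *)
rewrite -[LHS]subr0 -(mulr0 (r ^+ 4 / k)) -{1}r2; field.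
by rewrite k0 rn0.
Qed.

End FourPoints.

Unset Implicit Arguments.

Theorem theorem2 (R : realType) (g : R -> R * R) (L : R)
    (g_smooth : regular_smooth_curve g) (g_simple : closed_simple_curve g L) :
  exists p1 p2 q1 q2 : R * R,
    uniq [:: p1; p2; q1; q2] /\
    [/\ exists2 S, osculating_circline g p1 S & supports_from_inside S (range g) p1,
        exists2 S, osculating_circline g p2 S & supports_from_inside S (range g) p2,
        exists2 S, osculating_circline g q1 S & supports_from_outside S (range g) q1 &
        exists2 S, osculating_circline g q2 S & supports_from_outside S (range g) q2].
Proof.
have cc := smooth_closed_curve g_smooth g_simple.
have [s1 [s2 [t1 [t2 [un [h1 h2 h3 h4]]]]]] := four_points cc.
exists (g s1), (g s2), (g t1), (g t2); split=> //.
have reg t : velocity g t != 0 by case: g_smooth.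
have osc t : osculating_circline g (g t) (osculating_formula g t).
  by exists t => //; exact: osculating_circline_at_formula.
have on t : osculating_formula g t (g t).
  rewrite osculating_formulaE//= /osculating_form /sq /dot /= !subrr.
  by rewrite !mul0r !addr0 !mulr0 subrr.
have sub t A : zero_set_in g (velocity g) (acceleration g) t A -> osculating_formula g t `<=` A.
  by move=> h q; rewrite osculating_formulaE//; exact: h.
split; [exists (osculating_formula g s1)|exists (osculating_formula g s2)|
        exists (osculating_formula g t1)|exists (osculating_formula g t2)];
  try exact: osc; (split; [exact: on|by eexists|]); exact: sub.
Qed.
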